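(* The numbers $C_3(n)$ of $3$-noncrossing partitions of $[n]$ satisfy $C_3(0)=C_3(1)=1$ and, for all $n\ge 0$, $$9n(n+3)\,C_3(n)-2\left(5n^2+32n+42\right)C_3(n+1)+(n+7)(n+6)\,C_3(n+2)=0.$$ Equivalently, the generating function $\mathcal{C}(t)=\sum_{n\ge 0}C_3(n)t^n$ satisfies $$t^2(1-9t)(1-t)\frac{d^2}{dt^2}\mathcal{C}(t)+2t\left(5-27t+18t^2\right)\frac{d}{dt}\mathcal{C}(t)+10(2-3t)\,\mathcal{C}(t)-20=0.$$ Finally, as $n$ goes to infinity, $$C_3(n)\sim \frac{3^9\cdot 5}{2^5}\,\frac{\sqrt 3}{\pi}\,\frac{9^n}{n^7}.$$
   Context: A partition of $[n]=\{1,2,\ldots,n\}$ is a collection of nonempty, mutually disjoint subsets (blocks) of $[n]$ whose union is $[n]$ (there is exactly one partition of $[0]=\emptyset$). The standard representation of a partition $P$ of $[n]$ is the graph on vertex set $[n]$ whose edges are the pairs $(i,j)$ with $i<j$ such that $i$ and $j$ are in the same block of $P$ and are consecutive in that block (no element of the block lies strictly between $i$ and $j$). A $k$-crossing of $P$ is a collection of $k$ edges $(i_1,j_1),\ldots,(i_k,j_k)$ of its standard representation such that $i_1<i_2<\cdots<i_k<j_1<j_2<\cdots<j_k$. A partition is $k$-noncrossing if it has no $k$-crossing. $C_3(n)$ denotes the number of $3$-noncrossing partitions of $[n]$. *)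

(* Defs.v *)
From HB Require Import structures.
From mathcomp Require Import all_boot all_order all_algebra.
From mathcomp Require Import functions.

Set Implicit Arguments.
Unset Strict Implicit.
Unset Printing Implicit Defensive.

Import Order.TTheory GRing.Theory Num.Theory.

Local Open Scope ring_scope.

(* The ground set [n] = {1, ..., n} is modelled by 'I_n = {0, ..., n-1}: only  *)
(* the order of the points matters.  A partition of [n] is a                   *)
(* P : {set {set 'I_n}} with finset.partition P [set: 'I_n].                          *)

Definition std_edge (n : nat) (P : {set {set 'I_n}}) (e : 'I_n * 'I_n) : bool :=
  (e.1 < e.2)%N &&
  [exists B in P, [&& e.1 \in B, e.2 \in B &
     [forall l in B, ~~ ((e.1 < l)%N && (l < e.2)%N)]]].

(* The sortedness condition is the chain i_1 < ... < i_k < j_1 < ... < j_k.    *)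
Definition is_crossing (k n : nat) (P : {set {set 'I_n}})
    (t : k.-tuple ('I_n * 'I_n)) : bool :=
  all (std_edge P) t &&
  sorted ltn ([seq val e.1 | e <- t] ++ [seq val e.2 | e <- t]).

Definition noncrossing (k n : nat) (P : {set {set 'I_n}}) : bool :=
  ~~ [exists t : k.-tuple ('I_n * 'I_n), is_crossing P t].

Definition C3 (n : nat) : nat :=
  #|[set P : {set {set 'I_n}} | finset.partition P [set: 'I_n] & noncrossing 3 P]|.

(* A formal power series is its coefficient sequence.  The additive structure  *)
(* used on nat -> R is the pointwise one, but the product of series is the     *)
(* Cauchy product fps_mul, not the pointwise product.                          *)

Definition fps_of_poly (R : nzRingType) (p : {poly R}) : nat -> R :=
  fun n => p`_n.

Definition fps_mul (R : nzRingType) (a b : nat -> R) : nat -> R :=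
  fun n => \sum_(i < n.+1) a i * b (n - i)%N.

Definition fps_deriv (R : nzRingType) (a : nat -> R) : nat -> R :=
  fun n => a n.+1 *+ n.+1.

Definition C3_recurrence (R : nzRingType) (a : nat -> R) : Prop :=
  [/\ a 0%N = 1, a 1%N = 1 &
    forall n : nat,
      9 * n%:R * (n%:R + 3) * a n
      - 2 * (5 * n%:R ^+ 2 + 32 * n%:R + 42) * a n.+1
      + (n%:R + 7) * (n%:R + 6) * a n.+2 = 0].

Definition C3_ode (R : nzRingType) (a : nat -> R) : Prop :=
  fps_mul (fps_of_poly ('X^2 * (1 - 9 * 'X) * (1 - 'X)))
    (fps_deriv (fps_deriv a))
  + fps_mul (fps_of_poly (2 * 'X * (5 - 27 * 'X + 18 * 'X^2))) (fps_deriv a)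
  + fps_mul (fps_of_poly (10 * (2 - 3 * 'X))) a
  - fps_of_poly 20 = 0 :> (nat -> R).

(* Main.v *)
Require Import Defs.
From mathcomp Require Import all_boot all_order all_algebra ring lra zify.
From mathcomp Require Import boolp functions reals topology normedtype landau.
From mathcomp Require Import derive sequences realfun trigo.
Import Order.TTheory GRing.Theory Num.Theory.
Import numFieldNormedType.Exports.

Set Implicit Arguments.
Unset Strict Implicit.
Unset Printing Implicit Defensive.

(** Reading a 3-noncrossing partition from left to right, the positions that
    can still receive a successor fall into consecutive blocks, two of them
    being in the same block when some arc already drawn passes over both.
    Joining the new point to a position kills the later positions of its block
    and merges all later blocks, so only the composition [c] of block sizes
    matters.  The number of completions in [n + 1] steps turns out to be a
    linear functional of a product, over the parts of [c], of symmetric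
    polynomials in two variables; this identifies [C3 (n + 1)] with an
    alternating sum of coefficients of [K^n], where
    [K = (1 + x + y)(1 + 1/x + 1/y)], over an orbit of the group of order 12
    generated by [(p, q) -> (q, p)] and [(p, q) -> (p + q, -q)].

    The Euler derivatives of [K^n x^p y^q] have no constant term, and the
    resulting relations express every coefficient of [K^n] through those at
    [(0, 0)] and [(1, 0)], with rational functions of [n] as coefficients.  This
    gives the recurrence, and also the constant term
    [S(n) = sum_j C(n, j)^2 C(2j, j)] of [K^n] as a combination of [C3 (n + 1)]
    and [C3 (n + 2)] without cancellation in the leading order.  As
    [C3 (n + 1) / C3 n -> 9], it remains to estimate [S(n)].  The weights
    [C(n, j)^2 4^j] have explicit moments, hence so has a bound for the average
    of [C(2j, j) / 4^j ~ 1 / sqrt (pi j)] obtained by replacing the square root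
    by its tangents; the total weight is estimated in the same way. *)

Local Open Scope nat_scope.

(* Joining the new point to the [s]-th live position (from 0) of a block leaves
   the [s] positions before it, one merged block, and the new point. *)
Fixpoint closes (c : seq nat) : seq (seq nat) :=
  if c is p :: c' then
    [seq [:: s; sumn c'; 1%N] | s <- iota 0 p] ++ [seq p :: d | d <- closes c']
  else [::].

(** Number of ways to add [n] points to a state whose live blocks have sizes [c]; the appended part
    1 is a new point without predecessor. *)
Fixpoint ncount (n : nat) (c : seq nat) : nat :=
  if n is m.+1 then (ncount m (rcons c 1) + \sum_(d <- closes c) ncount m d)%N
  else 1.

(** * Arc words and their scanning automaton *)

(* A word records the predecessor, if any, of each point. *)
Definition arc (w : seq (option nat)) (i j : nat) : bool := nth None w j == Some i.

(** A letter holds at most one predecessor by construction, so the second clause only has to rule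
    out two successors of the same point. *)
Definition arc_word (w : seq (option nat)) : Prop :=
  (forall i j, arc w i j -> i < j) /\
  (forall i j k, arc w i j -> arc w i k -> j = k).

(* An arc from [k] to a new point would complete a 3-crossing. *)
Definition crossing2 (w : seq (option nat)) (k : nat) : Prop :=
  exists p q p' q', [/\ arc w p q, arc w p' q', p < p', p' < k & k < q < q'].

Definition crossing3 (w : seq (option nat)) : Prop :=
  exists k l, arc w k l /\
    exists p q p' q', [/\ arc w p q, arc w p' q', p < p', p' < k & k < q < q' /\ q' < l].

(* Joining the new point to [i] then rules out [k]. *)
Definition covers (w : seq (option nat)) (i k : nat) : Prop :=
  exists p q, [/\ arc w p q, p < i & k < q].

Definition avail (w : seq (option nat)) (i : nat) : Prop :=
  i < size w /\ forall j, ~~ arc w i j.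

Definition same (st : seq (seq nat)) (i k : nat) : bool :=
  has (fun b => (i \in b) && (k \in b)) st.

(** Invariant of the scan: [st] lists in increasing order the positions that a new point may join,
    grouped into classes for lying under a common arc. *)
Record scan_state (w : seq (option nat)) (st : seq (seq nat)) : Prop := ScanState {
  scan_sorted : sorted ltn (flatten st);
  scan_mem : forall i, i \in flatten st <-> avail w i /\ ~ crossing2 w i;
  scan_same : forall i k, i \in flatten st -> k \in flatten st -> i < k ->
    (same st i k <-> covers w i k) }.

Lemma arc_size w i j : arc w i j -> j < size w.
Proof. by rewrite ltnNge; apply: contraTN => le_wj; rewrite /arc nth_default. Qed.

Lemma arc_rcons w o i j :
  arc (rcons w o) i j = (j < size w) && arc w i j || (j == size w) && (o == Some i).
Proof.
rewrite /arc nth_rcons; case: ltngtP => //= _.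
by rewrite ?orbF.
Qed.

Lemma arc_rcons_old w o i j : arc w i j -> arc (rcons w o) i j.
Proof. by move=> a; rewrite arc_rcons a (arc_size a). Qed.

Lemma arc_rcons_new w i : arc (rcons w (Some i)) i (size w).
Proof. by rewrite arc_rcons !eqxx orbT. Qed.

Lemma arc_rconsP w o i j :
  arc (rcons w o) i j -> arc w i j \/ j = size w /\ o = Some i.
Proof. by rewrite arc_rcons => /orP[/andP[]|/andP[/eqP -> /eqP ->]]; [left|right]. Qed.

(** A new arc ends to the right of everything, so in a pair of crossing arcs over [k] it can only be
    the one that ends last. *)
Lemma crossing2_rcons w o k : k < size w ->
  crossing2 (rcons w o) k <->
  crossing2 w k \/ exists2 i, o = Some i & i < k /\ covers w i k.
Proof.
move=> ltk; split.
  case=> p [q [p' [q' [/arc_rconsP[a|[eq1 eq2]] /arc_rconsP[a'|[eq1' eq2']] lt1 lt2 lt3]]]].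
  - by left; exists p, q, p', q'.
  - by right; exists p' => //; split=> //; exists p, q; split=> //; lia.
  - by have := arc_size a'; lia.
  - lia.
case=> [[p [q [p' [q' [a a' lt1 lt2 lt3]]]]]|[i -> [lti [p [q [a lt1 lt2]]]]]].
  by exists p, q, p', q'; split=> //; apply: arc_rcons_old.
exists p, q, i, (size w); split=> //; [exact: arc_rcons_old|exact: arc_rcons_new|].
by rewrite lt2 (arc_size a).
Qed.

Lemma covers_rcons w o i k : k < size w ->
  covers (rcons w o) i k <-> covers w i k \/ exists2 p, o = Some p & p < i.
Proof.
move=> ltk; split.
  case=> p [q [/arc_rconsP[a|[-> ->]] lt1 lt2]]; first by left; exists p, q.
  by right; exists p.
case=> [[p [q [a lt1 lt2]]]|[p -> lt1]].
  by exists p, q; split=> //; apply: arc_rcons_old.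
by exists p, (size w); split=> //; apply: arc_rcons_new.
Qed.

Lemma avail_rcons w o i : i < size w ->
  avail (rcons w o) i <-> avail w i /\ o != Some i.
Proof.
move=> lti; rewrite /avail size_rcons; split.
  case=> _ na; split; first split=> // j.
    by apply/negP => /(arc_rcons_old o); apply/negP.
  by apply/eqP => e; have := na (size w); rewrite e arc_rcons_new.
case=> [[_ na] no]; split=> [|j]; first lia.
by apply/negP => /arc_rconsP[|[_ e]]; [apply/negP | rewrite e eqxx in no].
Qed.

(** Refines [closes] by remembering positions: the chosen predecessor comes with the blocks that
    remain before the new point is added. *)
Fixpoint splits (st : seq (seq nat)) : seq (nat * seq (seq nat)) :=
  if st is b :: st' then
    [seq (nth 0 b s, [:: take s b; flatten st']) | s <- iota 0 (size b)] ++
    [seq (x.1, b :: x.2) | x <- splits st']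
  else [::].

Lemma splitsP st x :
  x \in splits st <-> exists s1 b1 b2 s2,
    st = s1 ++ (b1 ++ x.1 :: b2) :: s2 /\ x.2 = s1 ++ [:: b1; flatten s2].
Proof.
elim: st x => [|b st IH] x; first by split=> // -[[|? ?] [? [? [? []]]]].
rewrite mem_cat; split.
  case/orP=> /mapP[].
    move=> s; rewrite mem_iota add0n => /= lts -> /=.
    exists [::], (take s b), (drop s.+1 b), st; split=> //.
    by rewrite /= -drop_nth // cat_take_drop.
  case=> i d /IH[s1 [b1 [b2 [s2 [-> /= e]]]]] -> /=.
  by exists (b :: s1), b1, b2, s2; rewrite e.
case: x => i d [[|b' s1] [b1 [b2 [s2 [/= [-> est] ->]]]]].
  apply/orP; left; apply/mapP; exists (size b1).
    by rewrite mem_iota size_cat /= addnS ltnS leq_addr.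
  by rewrite nth_cat ltnn subnn /= take_size_cat // est.
apply/orP; right; apply/mapP; exists (i, s1 ++ [:: b1; flatten s2]) => //.
by apply/IH; exists s1, b1, b2, s2.
Qed.

Lemma avail_new w o : arc_word (rcons w o) ->
  avail (rcons w o) (size w) /\ ~ crossing2 (rcons w o) (size w).
Proof.
case=> lt_arc _; split; first split=> [|j]; first by rewrite size_rcons.
  by apply/negP => a; have := lt_arc _ _ a; have := arc_size a; rewrite size_rcons; lia.
by case=> p [q [p' [q' [a _ _ _ ltq]]]]; have := arc_size a; rewrite size_rcons; lia.
Qed.

Lemma scan_lt w st i : scan_state w st -> i \in flatten st -> i < size w.
Proof. by case=> _ mem_st _ /mem_st[[]]. Qed.

Lemma same_mem st i k : same st i k -> (i \in flatten st) && (k \in flatten st).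
Proof.
case/hasP=> b b_st /andP[ib kb].
by apply/andP; split; apply/flattenP; exists b.
Qed.

(** Shared by both kinds of letter. Only the old positions need checking: no arc passes over the new
    point, which is therefore live and alone in its block. *)
Lemma scan_rcons w o st st' :
  arc_word (rcons w o) -> scan_state w st ->
  sorted ltn (flatten st') -> all (fun i => i < size w) (flatten st') ->
  (forall i, i < size w -> (i \in flatten st' <->
     i \in flatten st /\ (forall p, o = Some p -> i <> p /\ ~ (p < i /\ covers w p i)))) ->
  (forall i k, i \in flatten st' -> k \in flatten st' -> i < k ->
     (same st' i k <-> same st i k \/ exists2 p, o = Some p & p < i)) ->
  scan_state (rcons w o) (rcons st' [:: size w]).
Proof.
move=> ww [sort_st mem_st same_st] sort_st' lt_st' mem_st' same_st'.
have memE i : (i \in flatten (rcons st' [:: size w])) = (i \in flatten st') || (i == size w).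
  by rewrite flatten_rcons mem_cat inE.
have ltP i : i \in flatten st' -> i < size w by move/(allP lt_st').
have memP i : i < size w -> i \in flatten st' <->
    avail (rcons w o) i /\ ~ crossing2 (rcons w o) i.
  move=> lti; rewrite mem_st' // mem_st avail_rcons // crossing2_rcons //.
  split=> [[[av nx] ho]|[[av /eqP no] nx]].
    split; first by split=> //; apply/eqP => /ho[].
    by case=> // -[p /ho[_ nc] pc]; apply: nc.
  split; first by split=> // x; apply: nx; left.
  move=> p ep; split=> [eip|pc]; first by rewrite ep eip in no.
  by apply: nx; right; exists p.
split.
- rewrite flatten_rcons; move: sort_st' lt_st'; case: (flatten st') => [|a s] //=.
  rewrite cat_path /= andbT => -> /andP[lta /allP lts] /=.
  by have := mem_last a s; rewrite inE => /orP[/eqP ->|/lts].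
- move=> i; rewrite memE; split.
    by case/orP=> [ist|/eqP ->]; [apply/memP; rewrite ?ltP | apply: avail_new].
  case=> av nx; case: (ltngtP i (size w)) => [lti|gti|->]; rewrite ?orbT ?orbF //.
    by apply/memP.
  by case: av; rewrite size_rcons; lia.
move=> i k; rewrite !memE => ist kst lik.
have sameE : same (rcons st' [:: size w]) i k = same st' i k.
  rewrite /same has_rcons !inE; case: eqP => [ei|] //=; case: eqP => [ek|] //=.
  by lia.
rewrite sameE; case/orP: kst => [kst|/eqP ek]; last first.
  split=> [/same_mem/andP[_ /ltP]|[p [q [a _ ltk]]]]; first by rewrite ek ltnn.
  by have := arc_size a; rewrite size_rcons; lia.
have lik' := ltP _ kst; case/orP: ist => [ist|/eqP ei]; last by lia.
rewrite same_st' // covers_rcons //.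
have [ist0 _] := (mem_st' _ (ltP _ ist)).1 ist; have [kst0 _] := (mem_st' _ lik').1 kst.
by rewrite same_st.
Qed.

Lemma scan_none w st : arc_word (rcons w None) -> scan_state w st ->
  scan_state (rcons w None) (rcons st [:: size w]).
Proof.
move=> ww sst; apply: (scan_rcons ww sst).
- by case: sst.
- by apply/allP => i; apply: scan_lt.
- by move=> i _; split=> [|[]].
by move=> i k _ _ _; split=> [|[//|[]//]]; left.
Qed.

(** Positions after [i] in its block lie with [i] under an old arc, which crosses the new one over
    them, so they die. No old arc covers a position of a later block together with [i]; such
    positions survive and are now all under the new arc. *)
Lemma scan_some w s1 b1 i b2 s2 : arc_word (rcons w (Some i)) ->
  scan_state w (s1 ++ (b1 ++ i :: b2) :: s2) ->
  scan_state (rcons w (Some i)) (rcons (s1 ++ [:: b1; flatten s2]) [:: size w]).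
Proof.
move=> ww sst; have [sort_st mem_st same_st] := sst.
set st := s1 ++ _ in sst sort_st mem_st same_st.
have flatE : flatten st = flatten s1 ++ b1 ++ i :: b2 ++ flatten s2.
  by rewrite /st flatten_cat /= -!catA.
have flatE' : flatten (s1 ++ [:: b1; flatten s2]) = flatten s1 ++ b1 ++ flatten s2.
  by rewrite flatten_cat /= cats0.
have st_pair := sort_st; rewrite sorted_pairwise in st_pair; last exact: ltn_trans.
move: st_pair; rewrite flatE !pairwise_cat /= !pairwise_cat.
case/and5P=> /allrelP r1 _ /allrelP rb1 _ /and4P[/allP ri /allrelP rb2 _ _].
have ltF1 j : j \in flatten s1 -> j < i.
  by move=> jF; apply: r1; rewrite // mem_cat mem_head orbT.
have ltb1 j : j \in b1 -> j < i by move=> jb; apply: rb1; rewrite ?mem_head.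
have gtb2 j : j \in b2 -> i < j by move=> jb; apply: ri; rewrite mem_cat jb.
have gtF2 j : j \in flatten s2 -> i < j by move=> jF; apply: ri; rewrite mem_cat jF orbT.
have nb2F2 j : j \in b2 -> j \in flatten s2 -> False.
  by move=> jb jF; have := rb2 _ _ jb jF; rewrite /= ltnn.
have mem'E j : (j \in flatten (s1 ++ [:: b1; flatten s2])) =
    [|| j \in flatten s1, j \in b1 | j \in flatten s2] by rewrite flatE' !mem_cat.
have memE j : (j \in flatten st) =
    [|| j \in flatten s1, j \in b1, j == i, j \in b2 | j \in flatten s2].
  by rewrite flatE !mem_cat inE mem_cat.
have same'E j k : same (s1 ++ [:: b1; flatten s2]) j k =
    [|| same s1 j k, (j \in b1) && (k \in b1) | (j \in flatten s2) && (k \in flatten s2)].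
  by rewrite /same has_cat /= orbF.
have sameE j k : same st j k = [|| same s1 j k,
    [|| j \in b1, j == i | j \in b2] && [|| k \in b1, k == i | k \in b2] | same s2 j k].
  by rewrite /same has_cat /= !mem_cat !inE.
have ist : i \in flatten st by rewrite memE eqxx !orbT.
apply: (scan_rcons ww sst).
- move: sort_st; rewrite flatE flatE'; apply: (subseq_sorted ltn_trans).
  by rewrite !cat_subseq // -cat1s (catA [:: i]) suffix_subseq.
- apply/allP => j; rewrite mem'E => jst; apply: (scan_lt sst); rewrite memE.
  by case/or3P: jst => ->; rewrite ?orbT.
- move=> j _; rewrite mem'E memE; split.
    move=> jst; split; first by case/or3P: jst => ->; rewrite ?orbT.
    move=> _ [<-]; case/or3P: jst => [/ltF1 ltj|/ltb1 ltj|jF2]; try by split; lia.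
    have ltj := gtF2 _ jF2; split; first lia.
    case=> _; rewrite -same_st // ?memE ?jF2 ?orbT // sameE.
    case/or3P=> [/same_mem/andP[/ltF1]|/andP[_ /or3P[/ltb1|/eqP|/nb2F2/(_ jF2)//]]|];
      try by lia.
    by case/same_mem/andP=> /gtF2; rewrite ltnn.
  case=> /or4P[->|->|/eqP->|/orP[jb2|->]]; rewrite ?orbT //.
    by case/(_ i erefl).
  case/(_ i erefl) => _ []; split; first exact: gtb2.
  by apply/same_st; rewrite ?gtb2 // ?memE ?sameE ?jb2 ?eqxx ?orbT.
move=> j k; rewrite !mem'E same'E sameE => jst kst ltjk; split.
  case/or3P=> [->|/andP[-> ->]|/andP[/gtF2 ltj _]]; rewrite ?orbT; try by left.
  by right; exists i.
case=> [/or3P[->//|/andP[jb kb]|/same_mem ->]|[_ [<-] ltj]]; rewrite ?orbT //.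
  have nb j' : [|| j' \in flatten s1, j' \in b1 | j' \in flatten s2] ->
      [|| j' \in b1, j' == i | j' \in b2] -> j' \in b1.
    case/or3P=> [/ltF1 ltj|//|jF2] /or3P[//|/eqP e|jb2].
    - by rewrite e ltnn in ltj.
    - by have := ltn_trans ltj (gtb2 _ jb2); rewrite ltnn.
    - by have := gtF2 _ jF2; rewrite e ltnn.
    - by case: (nb2F2 j').
  by rewrite (nb _ jst jb) (nb _ kst kb) ?orbT.
have inF2 j' : i < j' -> [|| j' \in flatten s1, j' \in b1 | j' \in flatten s2] ->
    j' \in flatten s2.
  by move=> lti /or3P[/ltF1/(ltn_trans lti)|/ltb1/(ltn_trans lti)|//]; rewrite ltnn.
by rewrite (inF2 _ ltj jst) (inF2 _ (ltn_trans ltj ltjk) kst) !orbT.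
Qed.

(** * Enumeration of the 3-noncrossing words *)

Fixpoint gen (n : nat) (st : seq (seq nat)) (t : nat) : seq (seq (option nat)) :=
  if n is m.+1 then
    [seq None :: v | v <- gen m (rcons st [:: t]) t.+1] ++
    flatten [seq [seq Some x.1 :: v | v <- gen m (rcons x.2 [:: t]) t.+1] | x <- splits st]
  else [:: [::]].

(** The branching depends on the block sizes alone, so the actual positions can be forgotten. *)
Lemma size_gen n st t : size (gen n st t) = ncount n (map size st).
Proof.
elim: n st t => [//|n IH] st t /=.
rewrite size_cat size_map IH map_rcons; congr (_ + _).
have <- : [seq map size (rcons x.2 [:: t]) | x <- splits st] = closes (map size st).
  elim: st => [//|b st IHst] /=; rewrite map_cat -IHst -!map_comp; congr (_ ++ _).
    apply/eq_in_map => s; rewrite mem_iota /= add0n => lts.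
    by rewrite size_take lts size_flatten.
rewrite size_flatten sumnE !big_map; apply: eq_bigr => x _.
by rewrite size_map IH.
Qed.

Lemma gen_cons n st t o v : (o :: v \in gen n.+1 st t) <->
  if o is Some i then exists2 d, (i, d) \in splits st & v \in gen n (rcons d [:: t]) t.+1
  else v \in gen n (rcons st [:: t]) t.+1.
Proof.
rewrite /= mem_cat; split.
  case/orP=> [/mapP[v' v'g [-> ->]] //|/flatten_mapP[[i d] xs /mapP[v' v'g [-> ->]]]].
  by exists d.
case: o => [i [d xs vg]|vg]; last by rewrite map_f.
by apply/orP; right; apply/flatten_mapP; exists (i, d) => //; rewrite map_f.
Qed.

Lemma arc_cat w v i j : arc w i j -> arc (w ++ v) i j.
Proof. by move=> a; rewrite /arc nth_cat (arc_size a). Qed.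

Lemma crossing3_cat w v : crossing3 w -> crossing3 (w ++ v).
Proof.
case=> k [l [a [p [q [p' [q' [b c ? ? ?]]]]]]]; exists k, l; split; first exact: arc_cat.
by exists p, q, p', q'; split=> //; apply: arc_cat.
Qed.

Lemma crossing3_rcons w o :
  crossing3 (rcons w o) -> crossing3 w \/ exists2 i, o = Some i & crossing2 w i.
Proof.
case=> k [l [a [p [q [p' [q' [b c ltp ltp' [/andP[ltkq ltq] ltq']]]]]]]].
have lel : l <= size w by have := arc_size a; rewrite size_rcons.
case/arc_rconsP: b => [b|[eq _]]; last by lia.
case/arc_rconsP: c => [c|[eq _]]; last by lia.
case/arc_rconsP: a => [a|[_ ->]].
  by left; exists k, l; split=> //; exists p, q, p', q'; rewrite ltkq ltq.
by right; exists k => //; exists p, q, p', q'; rewrite ltkq.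
Qed.

Lemma crossing3_new w i : crossing2 w i -> crossing3 (rcons w (Some i)).
Proof.
case=> p [q [p' [q' [a b ltp ltp' /andP[ltiq ltq]]]]].
exists i, (size w); split; first exact: arc_rcons_new.
exists p, q, p', q'; rewrite ltiq ltq (arc_size b).
by split=> //; apply: arc_rcons_old.
Qed.

Lemma arc_word_none w : arc_word w -> arc_word (rcons w None).
Proof.
case=> lt_w inj_w; have arcE i j : arc (rcons w None) i j -> arc w i j.
  by case/arc_rconsP=> // -[].
by split=> [i j /arcE/lt_w|i j k /arcE + /arcE]; last exact: inj_w.
Qed.

Lemma arc_word_some w i : arc_word w -> avail w i -> arc_word (rcons w (Some i)).
Proof.
case=> lt_w inj_w [lti nav]; split=> [j k|j k l].
  by case/arc_rconsP=> [/lt_w //|[-> [<-]]].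
case/arc_rconsP=> [a|[-> [ej]]] /arc_rconsP[b|[-> [ej']]] //; first exact: inj_w a b.
  by rewrite ej' (negPf (nav _)) in a || rewrite -ej' (negPf (nav _)) in a.
by rewrite -ej (negPf (nav _)) in b.
Qed.

(** Soundness and completeness of the automaton. In a valid word the next predecessor is available
    because a point has one successor, and no crossing pair lies over it because a 3-crossing would
    result; so the invariant lists it as live. *)
Lemma gen_mem n w st v : arc_word w -> ~ crossing3 w -> scan_state w st ->
  (v \in gen n st (size w)) <->
  [/\ size v = n, arc_word (w ++ v) & ~ crossing3 (w ++ v)].
Proof.
elim: n w st v => [|n IH] w st v ww nx sst.
  rewrite inE; split=> [/eqP->|[/size0nil -> _ _]//]; by rewrite cats0.
case: v => [|o v].
  by split=> [|[]//]; rewrite /= mem_cat => /orP[/mapP[]|/flatten_mapP[? _ /mapP[]]].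
rewrite gen_cons -cat_rcons -(size_rcons w o); case: o => [i|]; last first.
  have ww' := arc_word_none ww; rewrite IH //.
  - by split=> [[<-]|[[<-]]].
  - by case/crossing3_rcons=> // -[].
  by apply: scan_none ww' sst.
split.
  case=> d /splitsP[s1 [b1 [b2 [s2 [/= est ->]]]]].
  have ist : i \in flatten st by rewrite est flatten_cat /= !mem_cat mem_head !orbT.
  have [av nx2] := (scan_mem sst i).1 ist; have ww' := arc_word_some ww av.
  rewrite IH //; first by case=> <-.
    by case/crossing3_rcons=> // -[_ [<-]].
  by rewrite est in sst; apply: scan_some ww' sst.
case=> -[sz] wwv nxv.
have a : arc (rcons w (Some i) ++ v) i (size w) by apply/arc_cat/arc_rcons_new.
have av : avail w i.
  split=> [|j]; first exact: wwv.1 a.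
  apply/negP => a'; have := arc_size a'.
  by rewrite (wwv.2 _ _ _ (arc_cat v (arc_rcons_old _ a')) a) ltnn.
have nx2 : ~ crossing2 w i.
  by move/crossing3_new/(crossing3_cat v).
have /flattenP[b bst ib] := (scan_mem sst i).2 (conj av nx2).
have [s1 [s2 est]] : exists s1 s2, st = s1 ++ b :: s2.
  by case/splitPr: bst => s1 s2; exists s1, s2.
have [b1 [b2 eb]] : exists b1 b2, b = b1 ++ i :: b2.
  by case/splitPr: ib => b1 b2; exists b1, b2.
have ww' := arc_word_some ww av; rewrite eb in est.
exists (s1 ++ [:: b1; flatten s2]); first by apply/splitsP; exists s1, b1, b2, s2.
rewrite IH //; first by case/crossing3_rcons=> // -[_ [<-]].
by rewrite est in sst; apply: scan_some ww' sst.
Qed.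

Lemma map_fst_splits st : [seq x.1 | x <- splits st] = flatten st.
Proof.
elim: st => [//|b st IH] /=; rewrite map_cat -IH -!map_comp; congr (_ ++ _).
by rewrite -[RHS](mkseq_nth 0).
Qed.

(** Different branches start with different letters, because the live positions are strictly
    increasing. *)
Lemma gen_uniq n w st : arc_word w -> scan_state w st -> uniq (gen n st (size w)).
Proof.
elim: n w st => [//|n IH] w st ww sst /=.
rewrite cat_uniq map_inj_uniq; last by move=> ? ? [].
have ww' := arc_word_none ww; have sst' := scan_none ww' sst.
have := IH _ _ ww' sst'; rewrite size_rcons => -> /=; apply/andP; split.
  apply/hasPn => v /flatten_mapP[x _ /mapP[v' _ ->]].
  by apply/negP => /mapP[].
have uniq_fst : uniq [seq x.1 | x <- splits st].
  by rewrite map_fst_splits; apply: sorted_uniq (scan_sorted sst);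
    [exact: ltn_trans|exact: ltnn].
(* Generalized to sublists of [splits st], so that the induction keeps the state [st] fixed. *)
suff flat_uniq r : {subset r <= splits st} -> uniq [seq x.1 | x <- r] ->
    uniq (flatten [seq [seq Some x.1 :: v | v <- gen n (rcons x.2 [:: size w]) (size w).+1]
                  | x <- r]) by exact: flat_uniq.
elim: r => [//|[i d] r IHr] sub /= /andP[nir ur].
rewrite cat_uniq IHr //; last by move=> x xr; apply: sub; rewrite inE xr orbT.
rewrite andbT map_inj_uniq; last by move=> ? ? [].
have ist : i \in flatten st.
  by rewrite -map_fst_splits; apply/mapP; exists (i, d) => //; apply/sub/mem_head.
have wwi := arc_word_some ww ((scan_mem sst i).1 ist).1.
have [s1 [b1 [b2 [s2 [/= est ->]]]]] := (splitsP _ _).1 (sub _ (mem_head _ _)).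
have sst2 : scan_state (rcons w (Some i)) (rcons (s1 ++ [:: b1; flatten s2]) [:: size w]).
  by rewrite est in sst; apply: scan_some wwi sst.
have := IH _ _ wwi sst2; rewrite size_rcons => -> /=.
apply/hasPn => v /flatten_mapP[[i' d'] xr /mapP[v' _ -> /=]].
apply/negP => /mapP[v'' _ [ei _]]; move/negP: nir; apply.
by apply/mapP; exists (i', d').
Qed.

Lemma arc_nil i j : ~~ arc [::] i j.
Proof. by rewrite /arc nth_nil. Qed.

Lemma gen_nilP n v : (v \in gen n [::] 0) <-> [/\ size v = n, arc_word v & ~ crossing3 v].
Proof.
apply: (@gen_mem n [::] [::] v).
- by split=> [i j|i j k]; rewrite (negPf (arc_nil _ _)).
- by case=> k [l []]; rewrite (negPf (arc_nil _ _)).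
by split=> // i; split=> // -[[]].
Qed.

Lemma gen_nil_uniq n : uniq (gen n [::] 0).
Proof.
apply: (@gen_uniq n [::] [::]); first by split=> [i j|i j k]; rewrite (negPf (arc_nil _ _)).
by split=> // i; split=> // -[[]].
Qed.

(** * Partitions and arc words *)

(* The fuel [j.+1] suffices in [label], since predecessors decrease. *)
Fixpoint root (w : seq (option nat)) (fuel j : nat) : nat :=
  if fuel is f.+1 then if nth None w j is Some i then root w f i else j else j.
(** The first point of the block of [j], used as a name for the block. *)
Definition label w j := root w j.+1 j.

Lemma root_fuel w f g j : arc_word w -> j < f -> j < g -> root w f j = root w g j.
Proof.
move=> [lt_w _]; elim: f g j => [//|f IH] [//|g] j ltf ltg /=.
case e: (nth None w j) => [i|//]; apply: IH; apply: leq_trans (lt_w i j _) _ => //;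
  by rewrite /arc e.
Qed.

Lemma label_arc w i j : arc_word w -> arc w i j -> label w j = label w i.
Proof.
move=> ww a; rewrite {1}/label [LHS]/= (eqP a).
by apply: root_fuel => //; apply: ww.1 a.
Qed.

Lemma label_none w j : nth None w j = None -> label w j = j.
Proof. by rewrite /label /= => ->. Qed.

Lemma label_le w j : arc_word w -> label w j <= j.
Proof.
move=> ww; elim/ltn_ind: j => j IH; case e: (nth None w j) => [i|].
  have a : arc w i j by rewrite /arc e.
  by rewrite (label_arc ww a); apply: leq_trans (IH _ _) (ltnW _); apply: ww.1 a.
by rewrite label_none.
Qed.

(** Without a predecessor [j] would be its own label, which exceeds the label of [i]; and the
    predecessor cannot jump back over [i]. *)
Lemma label_pred w i j : arc_word w -> i < j -> label w i = label w j ->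
  exists2 k, arc w k j & i <= k.
Proof.
move=> ww; elim/ltn_ind: j i => j IH i ltij eij; case e: (nth None w j) => [k|]; last first.
  by have := label_le i ww; rewrite eij (label_none e) leqNgt ltij.
have a : arc w k j by rewrite /arc e.
exists k => //; rewrite leqNgt; apply/negP => ltki.
have ekl : label w k = label w i by rewrite eij (label_arc ww a).
(* Predecessors of [l] descend within the block without skipping [k], by the outer induction; they
   reach [k] and give it a second successor. *)
have succ l : k < l -> l < j -> label w k = label w l -> False.
  elim/ltn_ind: l => l IHl ltkl ltlj el.
  have [m am] := IH l ltlj k ltkl el; rewrite leq_eqVlt => /orP[/eqP ek|ltkm].
    by move: am; rewrite -ek => /(ww.2 _ _ _ a) ejl; rewrite ejl ltnn in ltlj.
  have ltml := ww.1 _ _ am; apply: (IHl m) => //; first exact: ltn_trans ltml ltlj.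
  by rewrite el; apply: label_arc am.
exact: (succ i).
Qed.

Definition word n (P : {set {set 'I_n}}) : seq (option nat) :=
  [seq omap val [pick i | std_edge P (i, j)] | j <- enum 'I_n].
Definition parts n (w : seq (option nat)) : {set {set 'I_n}} :=
  preim_partition (fun j : 'I_n => label w j) [set: 'I_n].

Lemma parts_partition n w : finset.partition (parts n w) [set: 'I_n].
Proof. exact: preim_partitionP. Qed.

Lemma std_edgeP n (P : {set {set 'I_n}}) (i j : 'I_n) : finset.partition P [set: 'I_n] ->
  reflect [/\ i < j, j \in pblock P i & forall l : 'I_n, l \in pblock P i -> ~~ (i < l < j)]
    (std_edge P (i, j)).
Proof.
case/and3P=> /eqP covP trivP _.
have inP k : k \in cover P by rewrite covP inE.
apply: (iffP andP) => /= [[ltij /exists_inP[B BP /and3P[iB jB /forall_inP hB]]]|[ltij jB hB]].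
  by rewrite (def_pblock trivP BP iB).
split=> //; apply/exists_inP; exists (pblock P i); first by rewrite pblock_mem.
rewrite mem_pblock inP jB; apply/forall_inP => l; exact: hB.
Qed.

Lemma mem_parts n w (i j : 'I_n) :
  (j \in pblock (parts n w) i) = (label w i == label w j).
Proof.
rewrite /parts /preim_partition pblock_equivalence_partition ?inE // => x y z _ _ _.
by split=> // /eqP ->.
Qed.

(** By [label_pred] the predecessor of a point is the nearest earlier point with the same label,
    which is what being consecutive in a block means. *)
Lemma std_edge_parts n w (i j : 'I_n) : arc_word w ->
  std_edge (parts n w) (i, j) = arc w i j.
Proof.
move=> ww; apply/idP/idP.
  case/(std_edgeP _ _ (parts_partition n w)) => ltij; rewrite mem_parts => /eqP eij hl.
  have [k a leik] := label_pred ww ltij eij; have ltkj := ww.1 _ _ a.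
  have ltkn : k < n by apply: ltn_trans ltkj _.
  have := hl (Ordinal ltkn); rewrite mem_parts eij /= (label_arc ww a) eqxx => /(_ isT).
  rewrite ltkj andbT -leqNgt => leki.
  by have -> : nat_of_ord i = k by apply/anti_leq; rewrite leik leki.
move=> a; apply/(std_edgeP _ _ (parts_partition n w)); rewrite mem_parts (label_arc ww a).
split=> //; first exact: ww.1 a.
move=> l; rewrite mem_parts => /eqP eil; apply/andP=> -[ltil ltlj].
have [k a' lelk] := label_pred ww ltlj (etrans (esym eil) (esym (label_arc ww a))).
have eik : nat_of_ord i = k by move: a a'; rewrite /arc => /eqP -> /eqP[].
by rewrite -eik leqNgt ltil in lelk.
Qed.

Lemma size_word n (P : {set {set 'I_n}}) : size (word P) = n.
Proof. by rewrite size_map size_enum_ord. Qed.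

Lemma arc_wordE n (P : {set {set 'I_n}}) (i j : 'I_n) : finset.partition P [set: 'I_n] ->
  arc (word P) i j = std_edge P (i, j).
Proof.
move=> pP; rewrite /arc (nth_map j) ?size_enum_ord // nth_ord_enum.
case: pickP => [k kj|nk] /=; last by rewrite nk.
apply/eqP/idP => [[eki]|ij]; first by have <- : k = i by apply: val_inj.
congr Some; case/(std_edgeP _ _ pP): ij => ltij jPi hi.
case/(std_edgeP _ _ pP): kj => ltkj jPk hk.
have [_ trivP _] := and3P pP.
have e : pblock P i = pblock P k by rewrite -(same_pblock trivP jPi) (same_pblock trivP jPk).
have covP (l : 'I_n) : l \in pblock P l.
  by rewrite mem_pblock; case/and3P: pP => /eqP -> _ _; rewrite inE.
apply/eqP; case: ltngtP => // lt.
  by have := hk i; rewrite -e covP lt ltij => /(_ isT).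
by have := hi k; rewrite e covP lt ltkj => /(_ isT).
Qed.

Lemma arc_wordP n (P : {set {set 'I_n}}) i j : arc (word P) i j ->
  exists i' j' : 'I_n, [/\ i = i', j = j' & std_edge P (i', j')].
Proof.
move=> a; have ltj := arc_size a; rewrite size_word in ltj.
pose j' := Ordinal ltj; move: a; rewrite /arc (nth_map j') ?size_enum_ord //.
rewrite -[j in nth _ _ j]/(nat_of_ord j') nth_ord_enum.
by case: pickP => //= k kj /eqP[<-]; exists k, j'.
Qed.

Lemma arc_word_word n (P : {set {set 'I_n}}) : finset.partition P [set: 'I_n] ->
  arc_word (word P).
Proof.
move=> pP; split=> [i j /arc_wordP[i' [j' [-> -> /(std_edgeP _ _ pP)[]]]] //|i j k].
case/arc_wordP=> i' [j' [-> -> /(std_edgeP _ _ pP)[ltj jP hj]]].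
case/arc_wordP=> i'' [k' [/val_inj <- -> /(std_edgeP _ _ pP)[ltk kP hk]]].
case: (ltngtP j' k') => // lt; first by have := hk _ jP; rewrite ltj lt.
by have := hj _ kP; rewrite ltk lt.
Qed.

(** Two facts are combined: the label of a point is a point of its block, and all points of a block
    have the same label. *)
Lemma label_word n (P : {set {set 'I_n}}) (i j : 'I_n) : finset.partition P [set: 'I_n] ->
  (label (word P) i == label (word P) j) = (j \in pblock P i).
Proof.
move=> pP; have ww := arc_word_word pP; have [_ trivP _] := and3P pP.
have selfP (l : 'I_n) : l \in pblock P l.
  by rewrite mem_pblock; case/and3P: pP => /eqP -> _ _; rewrite inE.
have rep (l : 'I_n) : exists2 r : 'I_n, label (word P) l = r & pblock P r = pblock P l.
  move: {2}(l : nat) (leqnn l) => m; elim: m l => [|m IH] l lelm.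
    exists l => //; apply/eqP; rewrite eqn_leq label_le //=.
    by apply: leq_trans lelm _.
  case e: (nth None (word P) l) => [k|]; last by exists l; rewrite ?label_none.
  have a : arc (word P) k l by rewrite /arc e.
  have [k' [l' [ek /val_inj el kl]]] := arc_wordP a; subst l' k.
  have ltkl := ww.1 _ _ a; case: (IH k'); first by rewrite -ltnS (leq_trans ltkl).
  move=> r er eP; exists r; first by rewrite (label_arc ww a).
  have [_ /(same_pblock trivP) -> _] := std_edgeP _ _ pP kl.
  exact: eP.
apply/eqP/idP => [e|].
  have [r er erP] := rep i; have [r' er' erP'] := rep j.
  suff er2 : r = r' by rewrite -erP er2 erP'.
  by apply: val_inj; rewrite /= -er -er'.
have lab_eq (l k : 'I_n) : k < l -> k \in pblock P l ->
    label (word P) k = label (word P) l.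
  have [m le_lm] := ubnP (l : nat); elim: m l k le_lm => // m IH l k lelm ltkl kl.
  have : (k \in pblock P l) && (k < l) by rewrite kl.
  (* The largest element of the block below [l] is its predecessor, so both have the same label. *)
  case/(@arg_maxnP _ _ (fun p : 'I_n => (p \in pblock P l) && (p < l)) val) => p /andP[pl
    ltpl] pmax.
  have epl := same_pblock trivP pl.
  have a : arc (word P) p l.
    rewrite arc_wordE //; apply/(std_edgeP _ _ pP); split; rewrite // epl // => q ql.
    apply/andP => -[ltpq ltql]; have : q <= p by apply: pmax; rewrite ql ltql.
    by rewrite leqNgt ltpq.
  rewrite (label_arc ww a); have : k <= p by apply: pmax; rewrite kl.
  rewrite leq_eqVlt => /orP[/eqP/val_inj -> //|ltkp].
  by apply: IH; rewrite ?epl // (leq_trans ltpl).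
case: (ltngtP i j) => [lt|lt|/val_inj -> //].
- by move=> ji; apply: (lab_eq j i) => //; rewrite (same_pblock trivP ji).
- by move=> ji; apply/esym/(lab_eq i j).
Qed.

Lemma parts_word n (P : {set {set 'I_n}}) : finset.partition P [set: 'I_n] ->
  parts n (word P) = P.
Proof.
move=> pP; rewrite -[RHS](equivalence_partition_pblock pP).
rewrite /parts /preim_partition; apply: eq_imset => i; apply/setP => j; rewrite !inE /=.
exact: label_word.
Qed.

Lemma word_parts n w : arc_word w -> size w = n -> word (parts n w) = w.
Proof.
move=> ww sz; apply: (@eq_from_nth _ None); first by rewrite size_word.
move=> j; rewrite size_word => ltj; pose j' := Ordinal ltj.
have arcE (i : 'I_n) : arc (word (parts n w)) i j' = arc w i j'.
  by rewrite arc_wordE ?parts_partition // std_edge_parts.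
case e: (nth None w j) => [i|].
  have a : arc w i j by rewrite /arc e.
  have lti : i < n := ltn_trans (ww.1 i j a) ltj.
  by have := arcE (Ordinal lti); rewrite /arc /= e eqxx => /eqP.
case e': (nth None (word (parts n w)) j) => [i|//].
have [i' [j'' [ei _ _]]] :
  exists i' j'' : 'I_n, [/\ i = i', j = j'' & std_edge (parts n w) (i', j'')].
  by apply: arc_wordP; rewrite /arc e'.
by have := arcE i'; rewrite /arc /= e e' ei eqxx.
Qed.

Lemma noncrossing_word n (P : {set {set 'I_n}}) : finset.partition P [set: 'I_n] ->
  noncrossing 3 P <-> ~ crossing3 (word P).
Proof.
move=> pP; split.
  move=> nc [k [l [a [p [q [p' [q' [b c lt1 lt2 [/andP[lt3 lt4] lt5]]]]]]]]].
  have [k1 [l1 [? ? kl]]] := arc_wordP a; subst k l.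
  have [p1 [q1 [? ? pq]]] := arc_wordP b; subst p q.
  have [p2 [q2 [? ? pq']]] := arc_wordP c; subst p' q'.
  case/negP: nc; apply/existsP; exists [tuple (p1, q1); (p2, q2); (k1, l1)].
  by rewrite /is_crossing /= kl pq pq' lt1 lt2 lt3 lt4 lt5.
move=> nx; apply/negP => /existsP[t]; case/tupleP: t => -[p q] t.
case/tupleP: t => -[p' q'] t; case/tupleP: t => -[k l] t; rewrite tuple0.
rewrite /is_crossing /= => /andP[/and4P[a b c _]].
case/and5P=> lt1 lt2 lt3 lt4 /andP[lt5 _].
apply: nx; exists k, l; split; first by rewrite arc_wordE.
by exists p, q, p', q'; rewrite !arc_wordE // lt3 lt4.
Qed.

(** [word] maps the 3-noncrossing partitions bijectively onto the words enumerated by [gen], with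
    [parts] as inverse. *)
Lemma C3_ncount n : C3 n = ncount n [::].
Proof.
rewrite -(size_gen n [::] 0) /C3 cardE; set A := [set P | _].
rewrite -(size_map (@word n)); apply: perm_size; apply: uniq_perm.
- rewrite map_inj_in_uniq ?enum_uniq // => P Q.
  rewrite !mem_enum !inE => /andP[pP _] /andP[pQ _] e.
  by rewrite -(parts_word pP) e parts_word.
- exact: gen_nil_uniq.
move=> w; apply/mapP/idP => [[P]|].
  rewrite mem_enum inE => /andP[pP /(noncrossing_word pP) nx] ->.
  by apply/gen_nilP; split; rewrite ?size_word //; apply: arc_word_word.
case/gen_nilP=> sz ww nx; exists (parts n w); last by rewrite word_parts.
have pw := parts_partition n w.
by rewrite mem_enum inE pw /=; apply/(noncrossing_word pw); rewrite word_parts.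
Qed.

Local Open Scope ring_scope.

(** * Counting the runs of the automaton *)

(* [ddiff_k] is the quotient of [(1 + x)^p x^k - (1 + y)^p y^k] by [x - y]. *)
Fixpoint ddiff0 (R : pzRingType) (x y : R) (p : nat) : R :=
  if p is q.+1 then (1 + x) ^+ q + (1 + y) * ddiff0 x y q else 0.
Definition ddiff1 (R : pzRingType) (x y : R) p : R := (1 + x) ^+ p + y * ddiff0 x y p.
Definition ddiff2 (R : pzRingType) (x y : R) p : R :=
  (1 + x) ^+ p * (x + y) + y ^+ 2 * ddiff0 x y p.

Lemma ddiff0E (R : comPzRingType) (x y : R) p :
  (1 + x) ^+ p = (1 + y) ^+ p + (x - y) * ddiff0 x y p.
Proof. by elim: p => [|p IH] /=; [ring | rewrite !exprS; move: IH => ->; ring]. Qed.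

Lemma ddiff0S (R : comPzRingType) (x y : R) p : ddiff0 x y p.+1 = ddiff0 x y p + ddiff1 x y p.
Proof. rewrite /ddiff1 /=; ring. Qed.

Lemma sum_ddiff1 (R : comPzRingType) (x y : R) p :
  \sum_(0 <= s < p) ddiff1 x y s = ddiff0 x y p.
Proof. by elim: p => [|p IH]; [rewrite big_geq | rewrite big_nat_recr //= IH -ddiff0S]. Qed.

(** The Leibniz rule for divided differences. *)
Lemma ddiff0D (R : comPzRingType) (x y : R) p s :
  ddiff0 x y (p + s) = (1 + x) ^+ s * ddiff0 x y p + (1 + y) ^+ p * ddiff0 x y s.
Proof.
elim: p => [|p IH]; first by rewrite add0n /=; ring.
by rewrite addSn /= IH exprD !exprS; ring.
Qed.

Lemma ddiff0_ddiff1 (R : comPzRingType) (x y : R) p s :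
  x * y * (ddiff0 x y p * ddiff1 x y s) = ddiff1 x y p * ddiff2 x y s - ddiff2 x y (p + s).
Proof. rewrite /ddiff1 /ddiff2 ddiff0D exprD !(ddiff0E x y); ring. Qed.

Lemma ddiff2E (R : comPzRingType) (x y : R) p :
  (x - y) * ddiff2 x y p = (1 + x) ^+ p * x ^+ 2 - (1 + y) ^+ p * y ^+ 2.
Proof. rewrite /ddiff2 (ddiff0E x y); ring. Qed.

(** Total weight of [closes c] without the factor [1 + x + y] of the new point, the weight of a
    composition being the product of [ddiff1] over its parts. *)
Fixpoint close_sum (R : pzRingType) (x y : R) (c : seq nat) : R :=
  if c is p :: c' then ddiff0 x y p * ddiff1 x y (sumn c') +
    ddiff1 x y p * close_sum x y c' else 0.

(** By [ddiff0_ddiff1] each part contributes a difference of [ddiff2] terms, and the sum telescopes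
    down to a single one in the total size. *)
Lemma close_sumE (R : comPzRingType) (x y : R) c :
  x * y * close_sum x y c = (x + y) * (\prod_(p <- c) ddiff1 x y p) - ddiff2 x y (sumn c).
Proof.
elim: c => [|p c IH]; first by rewrite big_nil /ddiff2 /=; ring.
by rewrite big_cons /= mulrDr ddiff0_ddiff1 (mulrCA _ (ddiff1 _ _ _)) IH; ring.
Qed.

Lemma ddiff1_1 (R : comPzRingType) (x y : R) : ddiff1 x y 1 = 1 + x + y.
Proof. rewrite /ddiff1 /=; ring. Qed.

Lemma closes_sum (R : comPzRingType) (x y : R) c :
  \sum_(d <- closes c) \prod_(p <- d) ddiff1 x y p = (1 + x + y) * close_sum x y c.
Proof.
elim: c => [|p c IH]; first by rewrite big_nil mulr0.
rewrite big_cat !big_map /= mulrDr; congr (_ + _).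
  rewrite -sum_ddiff1 /index_iota subn0 mulr_suml mulr_sumr; apply: eq_bigr => s _.
  by rewrite !big_cons big_nil ddiff1_1; ring.
under eq_bigr do rewrite big_cons.
by rewrite -mulr_sumr IH; ring.
Qed.

(** * Linear functionals on bivariate polynomials *)

Definition pfun (S : nzRingType) (V : zmodType) (F : nat -> S -> V) (f : {poly S}) : V :=
  \sum_(i < size f) F i f`_i.

Lemma pfunE (S : nzRingType) (V : zmodType) (F : nat -> S -> V) (f : {poly S}) N :
  (forall i, F i 0 = 0) -> (size f <= N)%N -> pfun F f = \sum_(i < N) F i f`_i.
Proof.
move=> F0 le_fN; rewrite /pfun -!(big_mkord xpredT (fun i => F i f`_i)).
rewrite [RHS](big_cat_nat (leq0n _) le_fN) /= [X in _ = _ + X]big1_seq ?addr0 //.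
by move=> i; rewrite mem_index_iota => /and3P[_ le_fi _]; rewrite nth_default.
Qed.

Lemma pfunB (S : nzRingType) (V : zmodType) (F : nat -> S -> V) (f g : {poly S}) :
  (forall i, zmod_morphism (F i)) -> pfun F (f - g) = pfun F f - pfun F g.
Proof.
move=> FB; have F0 i : F i 0 = 0 by rewrite -[X in F i X](subr0 0) FB subrr.
set N := maxn (size f) (size g).
rewrite !(pfunE (N := N) F0) ?leq_maxl ?leq_maxr //.
  by rewrite -sumrB; apply: eq_bigr => i _; rewrite coefB FB.
by rewrite (leq_trans (size_polyD _ _)) // size_polyN.
Qed.

Lemma pfunXM (S : nzRingType) (V : zmodType) (F : nat -> S -> V) (f : {poly S}) :
  (forall i, F i 0 = 0) -> pfun F ('X * f) = pfun (fun i => F i.+1) f.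
Proof.
move=> F0; rewrite (pfunE (N := (size f).+1)) // ?big_ord_recl.
  by rewrite coefXM F0 add0r; apply: eq_bigr => i _; rewrite coefXM.
by have [->|nzf] := eqVneq f 0; rewrite ?mulr0 ?size_poly0 // -commr_polyX size_mulX.
Qed.

Lemma pfunCM (S : nzRingType) (V : zmodType) (F : nat -> S -> V) c (f : {poly S}) :
  (forall i, F i 0 = 0) -> pfun F (c%:P * f) = pfun (fun i a => F i (c * a)) f.
Proof.
move=> F0; rewrite (pfunE (N := size f)) //.
  by apply: eq_bigr => i _; rewrite coefCM.
by rewrite mul_polyC size_scale_leq.
Qed.

Definition lin1 (R : nzRingType) (g : nat -> R) (p : {poly R}) : R :=
  pfun (fun i a => a * g i) p.
(** The functional with value [g i j] on [x^i y^j], where [x] is the outer variable ['X] and [y] the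
    inner one ['X%:P]. Multiplying by a variable amounts to shifting [g]. *)
Definition lin2 (R : nzRingType) (g : nat -> nat -> R) (f : {poly {poly R}}) : R :=
  pfun (fun i => lin1 (g i)) f.

Lemma lin1B (R : nzRingType) (g : nat -> R) : zmod_morphism (lin1 g).
Proof. by move=> p q; apply: pfunB => i a b; rewrite mulrBl. Qed.

Lemma lin2B (R : nzRingType) (g : nat -> nat -> R) : zmod_morphism (lin2 g).
Proof. by move=> f h; apply: pfunB => i; apply: lin1B. Qed.

Lemma lin1_0 (R : nzRingType) (g : nat -> R) : lin1 g 0 = 0.
Proof. by rewrite -(subrr (0 : {poly R})) lin1B subrr. Qed.

Lemma lin2_0 (R : nzRingType) (g : nat -> nat -> R) : lin2 g 0 = 0.
Proof. by rewrite -(subrr (0 : {poly {poly R}})) lin2B subrr. Qed.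

Lemma lin2D (R : nzRingType) (g : nat -> nat -> R) : {morph lin2 g : f h / f + h}.
Proof. by move=> f h; rewrite -[h in LHS]opprK lin2B -[- h]sub0r lin2B lin2_0 sub0r opprK. Qed.

Lemma lin2_sum (R : nzRingType) (g : nat -> nat -> R) (I : Type) (r : seq I) (F : I -> {poly
  {poly R}}) :
  lin2 g (\sum_(i <- r) F i) = \sum_(i <- r) lin2 g (F i).
Proof. exact: (big_morph _ (lin2D g) (lin2_0 g)). Qed.

Lemma lin2X (R : nzRingType) (g : nat -> nat -> R) f :
  lin2 g ('X * f) = lin2 (fun i => g i.+1) f.
Proof. by rewrite /lin2 pfunXM // => i; apply: lin1_0. Qed.

Lemma lin2Y (R : nzRingType) (g : nat -> nat -> R) f :
  lin2 g ('X%:P * f) = lin2 (fun i j => g i j.+1) f.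
Proof.
rewrite /lin2 pfunCM => [|i]; last exact: lin1_0.
by apply: eq_bigr => i _; rewrite /lin1 pfunXM // => j; rewrite mul0r.
Qed.

Lemma lin2_ext (R : nzRingType) (g h : nat -> nat -> R) f :
  (forall i j, g i j = h i j) -> lin2 g f = lin2 h f.
Proof.
by move=> e; apply: eq_bigr => i _; apply: eq_bigr => j _; rewrite e.
Qed.

Lemma lin2Dl (R : nzRingType) (g h : nat -> nat -> R) f :
  lin2 g f + lin2 h f = lin2 (fun i j => g i j + h i j) f.
Proof.
rewrite -big_split; apply: eq_bigr => i _; rewrite -big_split.
by apply: eq_bigr => j _; rewrite /= mulrDr.
Qed.

Lemma lin2Bl (R : nzRingType) (g h : nat -> nat -> R) f :
  lin2 g f - lin2 h f = lin2 (fun i j => g i j - h i j) f.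
Proof.
rewrite -sumrB; apply: eq_bigr => i _; rewrite -sumrB.
by apply: eq_bigr => j _; rewrite /= mulrBr.
Qed.

Lemma lin2_1 (R : nzRingType) (g : nat -> nat -> R) : lin2 g 1 = g 0%N 0%N.
Proof.
rewrite /lin2 /lin1 /pfun size_poly1 big_ord1 coef1 /= size_poly1 big_ord1.
by rewrite coef1 mul1r.
Qed.

Lemma lin2X0 (R : nzRingType) (g : nat -> nat -> R) m :
  (forall i, g i 0%N = 0) -> lin2 g ((1 + 'X) ^+ m) = 0.
Proof.
elim: m g => [|m IH] g g0; first by rewrite lin2_1.
by rewrite exprS mulrDl mul1r lin2D lin2X !IH ?addr0.
Qed.

Lemma lin2Y0 (R : nzRingType) (g : nat -> nat -> R) m :
  (forall i, g 0%N i = 0) -> lin2 g ((1 + 'X%:P) ^+ m) = 0.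
Proof.
elim: m g => [|m IH] g g0; first by rewrite lin2_1.
by rewrite exprS mulrDl mul1r lin2D lin2Y !IH ?addr0.
Qed.

Lemma ddiff1S (R : comPzRingType) (x y : R) p :
  ddiff1 x y p.+1 = ddiff1 x y p + x * (1 + x) ^+ p + y * ddiff1 x y p.
Proof. by rewrite /ddiff1 /= !exprS; ring. Qed.

Lemma coef2_1 (R : nzRingType) i j :
  (1 : {poly {poly R}})`_i`_j = ((i == 0) && (j == 0))%N%:R.
Proof. by rewrite coef1; case: (i == 0)%N; rewrite /= ?coef1 ?coef0. Qed.

Lemma ddiff1_coefs (R : comNzRingType) p : let A := ddiff1 'X 'X%:P p : {poly {poly R}} in
  [/\ A`_0`_0 = 1, A`_1`_0 = p%:R & A`_0`_1 = p%:R].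
Proof.
have X00 q : ((1 + 'X) ^+ q : {poly {poly R}})`_0`_0 = 1.
  elim: q => [|q IH]; first by rewrite expr0 coef2_1.
  by rewrite exprS mulrDl mul1r coefD coefXM addr0.
elim: p => [|p [IH00 IH10 IH01]] /=.
  by rewrite /ddiff1 /= mulr0 addr0 !coef2_1.
rewrite ddiff1S; move: (ddiff1 _ _ p) IH00 IH10 IH01 => A IH00 IH10 IH01.
by rewrite !(coefD, coefXM, coefCM) /= IH00 IH10 IH01 X00 !(addr0, coef0, add0r) -natr1.
Qed.

Lemma prod_ddiff1_coefs (R : comNzRingType) c :
  let F := \prod_(p <- c) ddiff1 'X 'X%:P p : {poly {poly R}} in
  [/\ F`_0`_0 = 1, F`_1`_0 = (sumn c)%:R & F`_0`_1 = (sumn c)%:R].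
Proof.
elim: c => [|p c [IH00 IH10 IH01]] /=; first by rewrite big_nil !coef2_1.
rewrite big_cons; move: (ddiff1_coefs R p); cbv zeta; move: (ddiff1 _ _ p) => A [A00 A10 A01].
rewrite !coefM !big_ord_recl !big_ord0 !addr0 /= !(coefD, coefM).
rewrite !big_ord_recl !big_ord0 /= !addr0.
by rewrite A00 A10 A01 IH00 IH10 IH01 natrD; split; rewrite ?mul1r ?mulr1 // addrC.
Qed.

Lemma size_closes c : size (closes c) = sumn c.
Proof. by elim: c => [|p c IH] //=; rewrite size_cat !size_map size_iota IH. Qed.

Lemma prod_rcons (R : comPzRingType) (F : nat -> R) c a :
  \prod_(p <- rcons c a) F p = F a * \prod_(p <- c) F p.
Proof. by rewrite -cats1 big_cat big_seq1 /= mulrC. Qed.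

Lemma pfun_delta (S : nzRingType) (V : zmodType) (F : nat -> S -> V) (f : {poly S}) k :
  (forall i, F i 0 = 0) -> (forall i s, i != k -> F i s = 0) -> pfun F f = F k f`_k.
Proof.
move=> F0 Fk; rewrite (pfunE (N := maxn (size f) k.+1)) ?leq_maxl //.
rewrite (bigD1 (Ordinal (leq_maxr (size f) k.+1))) //= big1 ?addr0 // => i ik.
exact: Fk.
Qed.

Lemma lin2_delta (R : nzRingType) a b (f : {poly {poly R}}) :
  lin2 (fun i j => ((i == a) && (j == b))%:R) f = f`_a`_b.
Proof.
rewrite /lin2 (@pfun_delta _ _ _ _ a) => [|i|i s /negPf ia]; last 2 first.
- exact: lin1_0.
- by rewrite /lin1 /pfun big1 // => j _; rewrite ia mulr0.
rewrite /lin1 (@pfun_delta _ _ _ _ b) ?eqxx ?mulr1 // => [i|i s /negPf ->].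
  by rewrite mul0r.
by rewrite andbF mulr0.
Qed.

(** [H n] vanishes on the axes and obeys the step recurrence of [K] off them, so [x y] at time
    [n + 1] becomes [(1 + x + y)(x y + x + y)] at time [n]. The [ddiff2] term left by [close_sumE],
    multiplied by [x - y], is a polynomial in [x] alone minus one in [y] alone, and the functional
    kills both. *)
Lemma ncount_lin2 (R : comNzRingType) (H : nat -> nat -> nat -> R) :
  (forall i j, H 0%N i j = ((i == 2) && (j == 1))%:R - ((i == 1) && (j == 2))%:R) ->
  (forall n i, H n i 0%N = 0) -> (forall n j, H n 0%N j = 0) ->
  (forall n i j, H n.+1 i.+1 j.+1 = 3 * H n i.+1 j.+1 + H n i.+2 j.+1 + H n i j.+1
     + H n i.+1 j.+2 + H n i.+1 j + H n i.+2 j + H n i j.+2) ->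
  forall n c, 2 * (ncount n.+1 c)%:R =
    lin2 (H n) (('X - 'X%:P) * ('X * 'X%:P + 'X + 'X%:P) * \prod_(p <- c) ddiff1 'X 'X%:P p).
Proof.
move=> H0 Hx Hy HS; set x := 'X; set y := 'X%:P.
elim=> [|n IH] c.
  have [F00 F10 F01] := prod_ddiff1_coefs R c.
  set F := \prod_(p <- c) _ in F00 F10 F01 *.
  have -> : (x - y) * (x * y + x + y) * F =
    x * (x * (y * F)) + x * (x * F) - y * (y * (x * F)) - y * (y * F) by ring.
  rewrite !lin2B !lin2D !(lin2X, lin2Y) !(lin2Dl, lin2Bl).
  pose d (a b i j : nat) : R := ((i == a) && (j == b))%:R.
  rewrite (@lin2_ext _ _ (fun i j => d 0%N 0%N i j + d 0%N 0%N i j + d 1%N 0%N i j +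
    d 0%N 1%N i j)); last first.
    by move=> i j; rewrite !H0 /d; case: i => [|[|[|i]]]; case: j => [|[|[|j]]] /=; ring.
  rewrite -!lin2Dl !lin2_delta F00 F10 F01 /= sum1_size size_closes.
  by rewrite -[(1 + _)%N]/((sumn c).+1) -natr1; ring.
rewrite -[ncount n.+2 c]/(ncount n.+1 (rcons c 1) + \sum_(d <- closes c) ncount n.+1 d)%N.
rewrite natrD mulrDr IH natr_sum mulr_sumr.
rewrite (eq_bigr _ (fun d _ => IH d)).
rewrite -lin2_sum -mulr_sumr prod_rcons closes_sum ddiff1_1.
set F := \prod_(p <- c) _; set D := close_sum _ _ _.
have step f : lin2 (H n.+1) (x * (y * f)) = lin2 (H n) ((1 + x + y) * (x * y + x + y) * f).
  have -> : (1 + x + y) * (x * y + x + y) * f = x * (y * f) + x * (y * f) + x * (y * f)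
    + x * (x * (y * f)) + y * f + x * (y * (y * f)) + x * f + x * (x * f) + y * (y * f) by ring.
  rewrite !lin2D !(lin2X, lin2Y) !lin2Dl; apply: lin2_ext => i j.
  by rewrite HS; ring.
have -> : (x - y) * (x * y + x + y) * F = x * (y * ((x - y) * (F + D))) +
   ((1 + x) ^+ sumn c * x ^+ 2 - (1 + y) ^+ sumn c * y ^+ 2).
  by rewrite -ddiff2E -[ddiff2 _ _ _](subKr ((x + y) * F)) -close_sumE -/D; ring.
rewrite lin2D step lin2B !(mulrC _ (_ ^+ 2)) !expr2 -!mulrA !(lin2X, lin2Y) lin2X0 // lin2Y0 //.
by rewrite -lin2D subrr addr0; congr lin2; ring.
Qed.

Definition hex : seq (int * int) :=
  [:: (1, 0); (-1, 0); (0, 1); (0, -1); (1, -1); (-1, 1)].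
Definition steps : seq (int * int) := nseq 3 0 ++ hex.

(** * Powers of the hexagonal kernel *)

(* The coefficient at [m] of the [n]-th power of
   [(1 + x + y)(1 + 1/x + 1/y)], whose support with multiplicity is [steps]. *)
Fixpoint walk (R : nzRingType) n (m : int * int) : R :=
  if n is k.+1 then \sum_(s <- steps) walk R k (m + s) else (m == 0)%:R.

(** * Symmetries of the kernel and the reflection principle *)

Definition flip (m : int * int) := (m.2, m.1).
Definition shear (m : int * int) := (m.1 + m.2, - m.2).

Lemma walk_sym (R : nzRingType) (f : int * int -> int * int) n m :
  (forall a b, f (a + b) = f a + f b) -> (forall a, f (f a) = a) ->
  perm_eq (map f steps) steps -> walk R n (f m) = walk R n m.
Proof.
move=> fD fK fs; have f0 : f 0 = 0 by apply: (addIr (f 0)); rewrite -fD !add0r.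
elim: n m => [|n IH] m /=; first by rewrite -{1}f0 (can_eq fK).
rewrite -(perm_big _ fs) big_map; apply: eq_bigr => s _.
by rewrite -fD IH.
Qed.

Lemma flipD a b : flip (a + b) = flip a + flip b. Proof. by case: a b => ? ? []. Qed.

Lemma flipK a : flip (flip a) = a. Proof. by case: a. Qed.

Lemma shearD a b : shear (a + b) = shear a + shear b.
Proof. case: a b => a1 a2 [b1 b2]; congr pair => /=; ring. Qed.

Lemma shearK a : shear (shear a) = a.
Proof. case: a => a1 a2; congr pair => /=; ring. Qed.

Lemma walk_flip (R : nzRingType) n m : walk R n (flip m) = walk R n m.
Proof. exact: (walk_sym R n m flipD flipK). Qed.

Lemma walk_shear (R : nzRingType) n m : walk R n (shear m) = walk R n m.
Proof. exact: (walk_sym R n m shearD shearK). Qed.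

(** The twelve images of [(2, 1)] under the group generated by [flip] and [shear], each with the
    determinant of the map that produces it. *)
Definition rho_orbit : seq ((int * int) * int) :=
  [:: ((2, 1), 1); ((1, 2), -1); ((3, -1), -1); ((-1, 3), 1); ((2, -3), -1);
      ((-3, 2), 1); ((-1, -2), -1); ((-2, -1), 1); ((-3, 1), -1); ((1, -3), 1);
      ((-2, 3), -1); ((3, -2), 1)].

(** Signed superposition of walks from the points of the orbit, as in the reflection principle:
    either reflection changes its sign. *)
Definition awalk (R : nzRingType) n (m : int * int) : R :=
  \sum_(w <- rho_orbit) walk R n (m - w.1) *~ w.2.

Lemma awalk_sym (R : nzRingType) (f : int * int -> int * int) n m :
  (forall a b, f (a + b) = f a + f b) -> (forall n m, walk R n (f m) = walk R n m) ->
  perm_eq [seq (f w.1, - w.2) | w <- rho_orbit] rho_orbit ->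
  awalk R n (f m) = - awalk R n m.
Proof.
move=> fD fW fs; rewrite /awalk -(perm_big _ fs) big_map -sumrN; apply: eq_bigr => w _.
have f0 : f 0 = 0 by apply: (addIr (f 0)); rewrite -fD !add0r.
have fN a : f (- a) = - f a by apply: (addIr (f a)); rewrite -fD !addNr.
by rewrite -fN -fD fW mulrNz.
Qed.

Lemma awalkS (R : nzRingType) n m :
  awalk R n.+1 m = \sum_(s <- steps) awalk R n (m + s).
Proof.
rewrite exchange_big; apply: eq_bigr => w _ /=.
by rewrite -mulrz_suml; congr (_ *~ _); apply: eq_bigr => s _; rewrite addrAC.
Qed.

Lemma awalk_flip (R : nzRingType) n p q : awalk R n (p, q) = - awalk R n (q, p).
Proof. exact: (@awalk_sym R flip n (q, p) flipD (walk_flip R)). Qed.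

(** The point [(p, 0)] is fixed by [shear], so the value there equals its own opposite. *)
Lemma awalk_wall (R : numDomainType) n p : awalk R n (p, 0) = 0.
Proof.
have := @awalk_sym R shear n (p, 0) shearD (walk_shear R) isT.
rewrite /shear /= addr0 oppr0 => /eqP; rewrite -addr_eq0 -mulr2n mulrn_eq0 /=.
by move/eqP.
Qed.

(* [v] is an Euler derivation: [v (K^(n+1)) = (n+1) K^n v(K)]. *)
Lemma walk_moment (R : comNzRingType) (v : int * int -> R) n m :
  (forall a b, v (a + b) = v a + v b) ->
  v m * walk R n.+1 m = - n.+1%:R * \sum_(s <- steps) v s * walk R n (m + s).
Proof.
move=> vD; have v0 : v 0 = 0 by apply: (addIr (v 0)); rewrite -vD !add0r.
elim: n m => [|n IH] m.
  rewrite /= mulr_sumr mulN1r -sumrN; apply: eq_bigr => s _.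
  have [/eqP|_] := eqVneq (m + s) 0; last by rewrite !mulr0 oppr0.
  by rewrite addr_eq0 => /eqP ->; rewrite !mulr1; apply: (addIr (v s)); rewrite -vD !addNr v0.
rewrite [walk _ _ m]/= mulr_sumr.
(* Writing [v m] as [v (m + s) - v s] makes the induction hypothesis applicable at [m + s]. *)
have -> : \sum_(s <- steps) v m * walk R n.+1 (m + s) =
  \sum_(s <- steps) v (m + s) * walk R n.+1 (m + s) -
  \sum_(s <- steps) v s * walk R n.+1 (m + s).
  by rewrite -sumrB; apply: eq_bigr => s _; rewrite vD -mulrBl addrK.
under eq_bigr do rewrite IH.
rewrite -mulr_sumr exchange_big /=.
have -> : \sum_(j <- steps) \sum_(i <- steps) v j * walk R n (m + i + j) =
  \sum_(s <- steps) v s * walk R n.+1 (m + s).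
  apply: eq_bigr => j _; rewrite -mulr_sumr; congr (_ * _) => /=.
  by apply: eq_bigr => i _; rewrite addrAC.
by rewrite -[n.+2%:R]natr1; ring.
Qed.

(** Only [(2, 1)] and [(1, 2)] in the orbit have both coordinates nonnegative. *)
Lemma awalk0 (R : nzRingType) (i j : nat) :
  awalk R 0 (i : int, j : int) = ((i == 2) && (j == 1))%N%:R - ((i == 1) && (j == 2))%N%:R.
Proof.
rewrite /awalk !big_cons big_nil /= !subr_eq0 !xpair_eqE !eqz_nat /= !andbF /=.
by rewrite !mulrN1z !mulr1z !oppr0 !addr0.
Qed.

Definition hw (R : nzRingType) n (p q : nat) : R := walk R n (p%:Z, q%:Z).

Lemma hwC (R : nzRingType) n p q : hw R n p q = hw R n q p.
Proof. exact: (walk_flip R n (q%:Z, p%:Z)). Qed.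

Lemma walk_m1 (R : nzRingType) n (p : nat) :
  walk R n (p.+1%:Z, - 1) = hw R n p 1.
Proof. by rewrite /hw -[RHS]walk_shear /shear /= addrC. Qed.

Lemma ptD (a b c d : int) : (a, b) + (c, d) = (a + c, b + d). Proof. by []. Qed.

Lemma posz1 (p : nat) : p%:Z + 1 = p.+1%:Z. Proof. by rewrite addrC. Qed.

Lemma poszN1 (p : nat) : p.+1%:Z + -1 = p%:Z. Proof. by rewrite -posz1 addrK. Qed.

Lemma big_steps (R : nzRingType) (f : int * int -> R) :
  \sum_(s <- steps) f s = 3 * f 0 + \sum_(s <- hex) f s.
Proof.
rewrite /steps; move: hex => h; rewrite /= !big_cons !addrA mulr_natl.
by rewrite !mulrS mulr0n addr0 addrA.
Qed.

(** Expanding the power [n + 1] by one step gives a relation between coefficients of a single power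
    of the kernel. *)
Lemma walk_moment_hex (R : comNzRingType) (v : int * int -> R) n m :
  (forall a b, v (a + b) = v a + v b) ->
  v m * (3 * walk R n m + \sum_(s <- hex) walk R n (m + s)) +
  n.+1%:R * \sum_(s <- hex) v s * walk R n (m + s) = 0.
Proof.
move=> vD; have v0 : v 0 = 0 by apply: (addIr (v 0)); rewrite -vD !add0r.
have := walk_moment n m vD.
rewrite [walk _ _ _]/= !big_steps v0 addr0 !mul0r mulr0 add0r => ->; ring.
Qed.

Lemma hwS (R : comNzRingType) n p q : hw R n.+1 p.+1 q.+1 =
  3 * hw R n p.+1 q.+1 + (hw R n p.+2 q.+1 + hw R n p q.+1 + hw R n p.+1 q.+2 +
    hw R n p.+1 q + hw R n p.+2 q + hw R n p q.+2).
Proof.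
rewrite {1}/hw [LHS]/= big_steps addr0 !big_cons !big_nil !ptD !(posz1, poszN1, addr0).
by rewrite -!/(hw _ _ _ _) !addrA.
Qed.

Lemma hwS0 (R : comNzRingType) n p : hw R n.+1 p.+1 0 =
  3 * hw R n p.+1 0 + (hw R n p.+2 0 + hw R n p 0 + 2 * hw R n p.+1 1 + 2 * hw R n p 1).
Proof.
rewrite {1}/hw [LHS]/= big_steps addr0 !big_cons !big_nil !ptD !(posz1, poszN1, addr0, add0r).
rewrite !walk_m1 -!/(hw _ _ _ _); ring.
Qed.

Lemma hw_rel1 (R : comNzRingType) n p q :
  p.+1%:R * (3 * hw R n p.+1 q.+1 + (hw R n p.+2 q.+1 + hw R n p q.+1 + hw R n p.+1 q.+2 +
    hw R n p.+1 q + hw R n p.+2 q + hw R n p q.+2)) +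
  n.+1%:R * (hw R n p.+2 q.+1 - hw R n p q.+1 + hw R n p.+2 q - hw R n p q.+2) = 0.
Proof.
have := @walk_moment_hex R (fun m => m.1%:~R) n (p.+1%:Z, q.+1%:Z) (fun a b => rmorphD _ _ _).
rewrite !big_cons !big_nil !ptD !(posz1, poszN1, addr0) -!/(hw _ _ _ _) /=.
by move=> <-; ring.
Qed.

Lemma hw_rel2 (R : comNzRingType) n p q :
  q.+1%:R * (3 * hw R n p.+1 q.+1 + (hw R n p.+2 q.+1 + hw R n p q.+1 + hw R n p.+1 q.+2 +
    hw R n p.+1 q + hw R n p.+2 q + hw R n p q.+2)) +
  n.+1%:R * (hw R n p.+1 q.+2 - hw R n p.+1 q - hw R n p.+2 q + hw R n p q.+2) = 0.
Proof.
have := @walk_moment_hex R (fun m => m.2%:~R) n (p.+1%:Z, q.+1%:Z) (fun a b => rmorphD _ _ _).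
rewrite !big_cons !big_nil !ptD !(posz1, poszN1, addr0) -!/(hw _ _ _ _) /=.
by move=> <-; ring.
Qed.

(** On the axis, the neighbours with second coordinate -1 are brought back into the quadrant by
    [shear]. *)
Lemma hw_rel0 (R : comNzRingType) n p :
  p.+1%:R * (3 * hw R n p.+1 0 + (hw R n p.+2 0 + hw R n p 0 + 2 * hw R n p.+1 1 +
    2 * hw R n p 1)) +
  n.+1%:R * (hw R n p.+2 0 - hw R n p 0 + hw R n p.+1 1 - hw R n p 1) = 0.
Proof.
have := @walk_moment_hex R (fun m => m.1%:~R) n (p.+1%:Z, 0) (fun a b => rmorphD _ _ _).
rewrite !big_cons !big_nil !ptD !(posz1, poszN1, addr0, add0r) !walk_m1.
rewrite -!/(hw _ _ _ _) /=.
by move=> <-; ring.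
Qed.

(** The six hexagonal steps form one orbit of the symmetry group. *)
Lemma hw00S (R : comNzRingType) n : hw R n.+1 0 0 = 3 * hw R n 0 0 + 6 * hw R n 1 0.
Proof.
rewrite {1}/hw [LHS]/= big_steps addr0 !big_cons !big_nil !ptD !(addr0, add0r).
have e1 : walk R n (1, 0) = hw R n 1 0 by [].
have e2 : walk R n (0, 1) = hw R n 1 0 by rewrite (hwC R n 1 0).
have e3 : walk R n (1, -1) = hw R n 1 0 by rewrite -e2 -walk_shear.
have e4 : walk R n (-1, 1) = hw R n 1 0 by rewrite -e3 -walk_flip.
have e5 : walk R n (0, -1) = hw R n 1 0 by rewrite -e4 -walk_shear.
have e6 : walk R n (-1, 0) = hw R n 1 0 by rewrite -e5 -walk_flip.
by rewrite e1 e2 e3 e4 e5 e6 -[walk R n _]/(hw R n 0 0); ring.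
Qed.

Lemma awalk21 (R : comNzRingType) n : awalk R n (2, 1) =
  hw R n 0 0 - hw R n 1 0 - hw R n 1 1 + 2 * hw R n 2 1 - hw R n 4 0 + 2 * hw R n 4 1
  - hw R n 3 3 + hw R n 4 2 - hw R n 5 0 - hw R n 2 2.
Proof.
have e (p q : nat) : walk R n (p%:Z, q%:Z) = hw R n p q by [].
have e1 p : walk R n (p.+2%:Z, - 2) = hw R n p 2 by rewrite -e -[RHS]walk_shear /shear /= addrC.
rewrite /awalk !big_cons big_nil /= !mulr1z !mulrN1z.
rewrite -[(2, 1) - (2, 1)]/(0%:Z, 0%:Z) -[(2, 1) - (1, 2)]/(1%:Z, - 1).
rewrite -[(2, 1) - (3, -1)]/(flip (2%:Z, -1)) -[(2, 1) - (-1, 3)]/(3%:Z, - 2).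
rewrite -[(2, 1) - (2, -3)]/(flip (4%:Z, 0%:Z)) -[(2, 1) - (-3, 2)]/(5%:Z, - 1).
rewrite -[(2, 1) - (-1, -2)]/(3%:Z, 3%:Z) -[(2, 1) - (-2, -1)]/(4%:Z, 2%:Z).
rewrite -[(2, 1) - (-3, 1)]/(5%:Z, 0%:Z) -[(2, 1) - (1, -3)]/(flip (4%:Z, 1%:Z)).
rewrite -[(2, 1) - (-2, 3)]/(4%:Z, - 2) -[(2, 1) - (3, -2)]/(flip (3%:Z, - 1)).
rewrite !walk_flip !e1 !walk_m1 !e (hwC _ _ 0 1) (hwC _ _ 1 2); ring.
Qed.

Lemma solve_linear (F : fieldType) (c t r : F) : c != 0 -> c * t + r = 0 -> t = - r / c.
Proof. by move=> c0 /eqP; rewrite addr_eq0 => /eqP <-; rewrite mulrAC divff ?mul1r. Qed.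

Lemma natrD_neq0 (R : numDomainType) n k : n%:R + k.+1%:R != 0 :> R.
Proof. by rewrite -natrD addnS pnatr_eq0. Qed.

(* Each closed form below is solved from a moment relation at a neighbouring
   point.  Numerals are unary, hence the base 1000 notation of large ones. *)
Lemma hw11 (R : numFieldType) n : hw R n 1 1 = (n%:R - 1) * hw R n 1 0 / (n%:R + 2).
Proof.
apply: (canRL (mulfK (natrD_neq0 R n 1))); case: n => [|n]; first by rewrite /hw /=; ring.
have swaps := (hwC R n 0 1, hwC R n 0 2, hwC R n 1 2).
have n2 := natrD_neq0 R n 1; have n3 := natrD_neq0 R n 2.
(* One step reduces both sides to coefficients of [K^n], where [r] and [s] eliminate those at
   [(2, 0)] and [(2, 1)]. An identity in those at [(0, 0)], [(1, 0)] and [(1, 1)] remains. *)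
have r : (n%:R + 2) * hw R n 2 0 +
    ((- n%:R + 4) * hw R n 1 0 + (- n%:R) * hw R n 0 0 + (n%:R + 3) * hw R n 1 1) = 0.
  by rewrite -[RHS](hw_rel0 R n 0) ?swaps; ring.
have s : (n%:R + 3) * hw R n 2 1 +
    (3 * hw R n 1 1 + (- n%:R + 1) * hw R n 1 0 + 2 * hw R n 2 0) = 0.
  by rewrite -[RHS](hw_rel1 R n 0 0) ?swaps; ring.
rewrite hwS hwS0 !swaps (solve_linear n3 s) (solve_linear n2 r).
by field; rewrite n2 n3.
Qed.

Lemma hw20 (R : numFieldType) n : hw R n 2 0 =
  ((n%:R ^+ 2 + 2 * n%:R) * hw R n 0 0 +
    (- 4 * n%:R - 5) * hw R n 1 0) / ((n%:R + 2) ^+ 2).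
Proof.
have swaps := (hwC R n 0 1, hwC R n 0 2, hwC R n 1 2, hwC R n 1 3, hwC R n 2 3).
have r : (n%:R + 2) * hw R n 2 0 +
    ((- n%:R + 4) * hw R n 1 0 + (- n%:R) * hw R n 0 0 + (n%:R + 3) * hw R n 1 1) = 0.
  by rewrite -[RHS](hw_rel0 R n 0) ?swaps; ring.
have n2 := natrD_neq0 R n 1.
rewrite (solve_linear n2 r) hw11.
by field; rewrite n2.
Qed.

Lemma hw21 (R : numFieldType) n : hw R n 2 1 =
  ((- 2 * n%:R ^+ 2 - 4 * n%:R) * hw R n 0 0 +
    (n%:R ^+ 3 + 5 * n%:R + 12) * hw R n 1 0) / ((n%:R + 2) ^+ 2 * (n%:R + 3)).
Proof.
have swaps := (hwC R n 0 1, hwC R n 0 2, hwC R n 1 2, hwC R n 1 3, hwC R n 2 3).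
have r : (n%:R + 3) * hw R n 2 1 +
    (3 * hw R n 1 1 + (- n%:R + 1) * hw R n 1 0 + 2 * hw R n 2 0) = 0.
  by rewrite -[RHS](hw_rel1 R n 0 0) ?swaps; ring.
have n2 := natrD_neq0 R n 1; have n3 := natrD_neq0 R n 2.
rewrite (solve_linear n3 r) hw20 hw11.
by field; rewrite n2 n3.
Qed.

Lemma hw30 (R : numFieldType) n : hw R n 3 0 =
  ((- 4 * n%:R ^+ 2 - 8 * n%:R) * hw R n 0 0 +
    (n%:R ^+ 3 + 17 * n%:R + 18) * hw R n 1 0) / ((n%:R + 2) * (n%:R + 3) ^+ 2).
Proof.
have swaps := (hwC R n 0 1, hwC R n 0 2, hwC R n 1 2, hwC R n 1 3, hwC R n 2 3).
have r : (n%:R + 3) * hw R n 3 0 +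
    (6 * hw R n 2 0 + (- n%:R + 1) * hw R n 1 0 + (n%:R + 5) * hw R n 2 1 + (- n%:R +
      3) * hw R n 1 1) = 0.
  by rewrite -[RHS](hw_rel0 R n 1) ?swaps; ring.
have n2 := natrD_neq0 R n 1; have n3 := natrD_neq0 R n 2.
rewrite (solve_linear n3 r) hw21 hw20 hw11.
by field; rewrite n2 n3.
Qed.

Lemma hw22 (R : numFieldType) n : hw R n 2 2 =
  ((n%:R ^+ 4 + 5 * n%:R ^+ 3 + 20 * n%:R ^+ 2 + 28 * n%:R) * hw R n 0 0 +
    (- 12 * n%:R ^+ 3 - 21 * n%:R ^+ 2 - 51 * n%:R - 78) * hw R n 1 0) / ((n%:R +
      2) ^+ 2 * (n%:R + 3) * (n%:R + 4)).
Proof.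
have swaps := (hwC R n 0 1, hwC R n 0 2, hwC R n 1 2, hwC R n 1 3, hwC R n 2 3).
have r : ((n%:R + 1) * (n%:R + 4)) * hw R n 2 2 +
    ((2 * n%:R + 2) * hw R n 1 1 +
     (- n%:R ^+ 2 - 3 * n%:R - 2) * hw R n 2 0 +
     (n%:R ^+ 2 + 9 * n%:R + 8) * hw R n 2 1 +
     (- n%:R ^+ 2 - 4 * n%:R - 3) * hw R n 3 0) = 0.
  (* [n + 3] times the second moment relation minus the first cancels the still unknown coefficient
     at [(3, 1)]. *)
  rewrite -[RHS](addr0 0) -[X in _ = X + _](mulr0 (n%:R + 3)) -[X in _ = _ +
    X](mulr0 (- 1)) -{1}(hw_rel2 R n 1 0).
  by rewrite -[X in _ = _ + _ * X](hw_rel1 R n 1 0) ?swaps; ring.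
have n1 := natrD_neq0 R n 0; have n2 := natrD_neq0 R n 1; have n3 := natrD_neq0 R n 2;
  have n4 := natrD_neq0 R n 3.
rewrite (solve_linear (mulf_neq0 n1 n4) r) hw21 hw30 hw20 hw11.
by field; rewrite n1 n2 n3 n4.
Qed.

Lemma hw31 (R : numFieldType) n : hw R n 3 1 =
  ((- 2 * n%:R ^+ 4 + 6 * n%:R ^+ 3 + 56 * n%:R ^+ 2 + 72 * n%:R) * hw R n 0 0 +
    (n%:R ^+ 5 - 2 * n%:R ^+ 4 - 7 * n%:R ^+ 3 - 34 * n%:R ^+ 2 - 174 * n%:R -
      180) * hw R n 1 0) / ((n%:R + 2) ^+ 2 * (n%:R + 3) ^+ 2 * (n%:R + 4)).
Proof.
have swaps := (hwC R n 0 1, hwC R n 0 2, hwC R n 1 2, hwC R n 1 3, hwC R n 2 3).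
have r : (n%:R + 3) * hw R n 3 1 +
    ((- n%:R + 7) * hw R n 2 1 + (- n%:R + 1) * hw R n 1 1 + 2 * hw R n 2 2 +
      2 * hw R n 2 0 + (n%:R + 3) * hw R n 3 0) = 0.
  by rewrite -[RHS](hw_rel1 R n 1 0) ?swaps; ring.
have n2 := natrD_neq0 R n 1; have n3 := natrD_neq0 R n 2; have n4 := natrD_neq0 R n 3.
rewrite (solve_linear n3 r) hw22 hw30 hw21 hw20 hw11.
by field; rewrite n2 n3 n4.
Qed.

Lemma hw32 (R : numFieldType) n : hw R n 3 2 =
  ((- 8 * n%:R ^+ 5 - 52 * n%:R ^+ 4 - 232 * n%:R ^+ 3 - 644 * n%:R ^+ 2 -
    648 * n%:R) * hw R n 0 0 +
    (n%:R ^+ 6 + 76 * n%:R ^+ 4 + 366 * n%:R ^+ 3 + 823 * n%:R ^+ 2 + 1794 * n%:R +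
      1692) * hw R n 1 0) / ((n%:R + 2) ^+ 2 * (n%:R + 3) ^+ 2 * (n%:R + 4) * (n%:R + 5)).
Proof.
have swaps := (hwC R n 0 1, hwC R n 0 2, hwC R n 1 2, hwC R n 1 3, hwC R n 2 3).
have r : (n%:R + 5) * hw R n 3 2 +
    (6 * hw R n 2 2 + (- n%:R + 3) * hw R n 2 1 + 4 * hw R n 3 1) = 0.
  by rewrite -[RHS](hw_rel1 R n 1 1) ?swaps; ring.
have n2 := natrD_neq0 R n 1; have n3 := natrD_neq0 R n 2; have n4 := natrD_neq0 R n 3;
  have n5 := natrD_neq0 R n 4.
rewrite (solve_linear n5 r) hw31 hw22 hw21.
by field; rewrite n2 n3 n4 n5.
Qed.

Lemma hw40 (R : numFieldType) n : hw R n 4 0 =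
  ((n%:R ^+ 6 + 10 * n%:R ^+ 5 + 65 * n%:R ^+ 4 + 224 * n%:R ^+ 3 + 336 * n%:R ^+ 2 +
    168 * n%:R) * hw R n 0 0 +
    (- 16 * n%:R ^+ 5 - 88 * n%:R ^+ 4 - 272 * n%:R ^+ 3 - 704 * n%:R ^+ 2 - 936 * n%:R -
      396) * hw R n 1 0) / ((n%:R + 2) ^+ 2 * (n%:R + 3) ^+ 2 * (n%:R + 4) ^+ 2).
Proof.
have swaps := (hwC R n 0 1, hwC R n 0 2, hwC R n 1 2, hwC R n 1 3, hwC R n 2 3).
have r : (n%:R + 4) * hw R n 4 0 +
    (9 * hw R n 3 0 + (- n%:R + 2) * hw R n 2 0 + (n%:R + 7) * hw R n 3 1 + (- n%:R +
      5) * hw R n 2 1) = 0.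
  by rewrite -[RHS](hw_rel0 R n 2) ?swaps; ring.
have n2 := natrD_neq0 R n 1; have n3 := natrD_neq0 R n 2; have n4 := natrD_neq0 R n 3.
rewrite (solve_linear n4 r) hw31 hw30 hw21 hw20.
by field; rewrite n2 n3 n4.
Qed.

Lemma hw41 (R : numFieldType) n : hw R n 4 1 =
  ((- 6 * n%:R ^+ 5 - 24 * n%:R ^+ 4 - 126 * n%:R ^+ 3 - 588 * n%:R ^+ 2 -
    768 * n%:R) * hw R n 0 0 +
    (n%:R ^+ 6 - 3 * n%:R ^+ 5 + 49 * n%:R ^+ 4 + 237 * n%:R ^+ 3 + 490 * n%:R ^+ 2 +
      1890 * n%:R + 1872) * hw R n 1 0) / ((n%:R + 2) * (n%:R + 3) ^+ 2 * (n%:R +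
      4) ^+ 2 * (n%:R + 5)).
Proof.
have swaps := (hwC R n 0 1, hwC R n 0 2, hwC R n 1 2, hwC R n 1 3, hwC R n 2 3).
have r : (n%:R + 4) * hw R n 4 1 +
    (9 * hw R n 3 1 + (- n%:R + 2) * hw R n 2 1 + 3 * hw R n 3 2 + 3 * hw R n 3 0 + (n%:R +
      4) * hw R n 4 0 + (- n%:R + 2) * hw R n 2 2) = 0.
  by rewrite -[RHS](hw_rel1 R n 2 0) ?swaps; ring.
have n2 := natrD_neq0 R n 1; have n3 := natrD_neq0 R n 2; have n4 := natrD_neq0 R n 3;
  have n5 := natrD_neq0 R n 4.
rewrite (solve_linear n4 r) hw40 hw32 hw31 hw22 hw30 hw21.
by field; rewrite n2 n3 n4 n5.
Qed.

Lemma hw50 (R : numFieldType) n : hw R n 5 0 =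
  ((- 12 * n%:R ^+ 7 - 144 * n%:R ^+ 6 - 972 * n%:R ^+ 5 - (4 * 1000 + 56) * n%:R ^+ 4 -
    (8 * 1000 + 976) * n%:R ^+ 3 - (8 * 1000 + 832) * n%:R ^+ 2 - (2 * 1000 +
    496) * n%:R) * hw R n 0 0 +
    (n%:R ^+ 8 + 4 * n%:R ^+ 7 + 158 * n%:R ^+ 6 + 1360 * n%:R ^+ 5 + (5 * 1000 +
      333) * n%:R ^+ 4 + (14 * 1000 + 404) * n%:R ^+ 3 + (25 * 1000 + 828) * n%:R ^+ 2 +
      (22 * 1000 + 752) * n%:R + (6 * 1000 + 624)) * hw R n 1 0) / ((n%:R +
      2) ^+ 2 * (n%:R + 3) ^+ 2 * (n%:R + 4) ^+ 2 * (n%:R + 5) ^+ 2).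
Proof.
have swaps := (hwC R n 0 1, hwC R n 0 2, hwC R n 1 2, hwC R n 1 3, hwC R n 2 3).
have r : (n%:R + 5) * hw R n 5 0 +
    (12 * hw R n 4 0 + (- n%:R + 3) * hw R n 3 0 + (n%:R + 9) * hw R n 4 1 + (- n%:R +
      7) * hw R n 3 1) = 0.
  by rewrite -[RHS](hw_rel0 R n 3) ?swaps; ring.
have n2 := natrD_neq0 R n 1; have n3 := natrD_neq0 R n 2; have n4 := natrD_neq0 R n 3;
  have n5 := natrD_neq0 R n 4.
rewrite (solve_linear n5 r) hw41 hw40 hw31 hw30.
by field; rewrite n2 n3 n4 n5.
Qed.

Lemma hw33 (R : numFieldType) n : hw R n 3 3 =
  ((- 4 * n%:R ^+ 6 + 68 * n%:R ^+ 5 + 564 * n%:R ^+ 4 + (2 * 1000 + 524) * n%:R ^+ 3 +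
    (6 * 1000 + 688) * n%:R ^+ 2 + (6 * 1000 + 576) * n%:R) * hw R n 0 0 +
    (n%:R ^+ 7 - 10 * n%:R ^+ 6 + 4 * n%:R ^+ 5 - 730 * n%:R ^+ 4 - (3 * 1000 +
      869) * n%:R ^+ 3 - (8 * 1000 + 980) * n%:R ^+ 2 - (18 * 1000 + 600) * n%:R -
      (17 * 1000 + 64)) * hw R n 1 0) / ((n%:R + 2) ^+ 2 * (n%:R + 3) ^+ 2 * (n%:R +
      4) * (n%:R + 5) * (n%:R + 6)).
Proof.
have swaps := (hwC R n 0 1, hwC R n 0 2, hwC R n 1 2, hwC R n 1 3, hwC R n 2 3).
have r : ((n%:R + 1) * (n%:R + 6)) * hw R n 3 3 +
    ((4 * n%:R + 4) * hw R n 2 2 +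
     (- n%:R ^+ 2 - 3 * n%:R - 2) * hw R n 3 1 +
     (n%:R ^+ 2 + 15 * n%:R + 14) * hw R n 3 2 +
     (- n%:R ^+ 2 - 5 * n%:R - 4) * hw R n 4 1) = 0.
  (* The factors [n + 4] and [-2] cancel the still unknown coefficient at [(4, 2)]. *)
  rewrite -[RHS](addr0 0) -[X in _ = X + _](mulr0 (n%:R + 4)) -[X in _ = _ +
    X](mulr0 (- 2)) -{1}(hw_rel2 R n 2 1).
  by rewrite -[X in _ = _ + _ * X](hw_rel1 R n 2 1) ?swaps; ring.
have n1 := natrD_neq0 R n 0; have n2 := natrD_neq0 R n 1; have n3 := natrD_neq0 R n 2;
  have n4 := natrD_neq0 R n 3; have n5 := natrD_neq0 R n 4; have n6 := natrD_neq0 R n 5.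
rewrite (solve_linear (mulf_neq0 n1 n6) r) hw41 hw32 hw31 hw22.
by field; rewrite n1 n2 n3 n4 n5 n6.
Qed.

Lemma hw42 (R : numFieldType) n : hw R n 4 2 =
  ((n%:R ^+ 8 + 15 * n%:R ^+ 7 + 193 * n%:R ^+ 6 + 1197 * n%:R ^+ 5 + (4 * 1000 +
    630) * n%:R ^+ 4 + (14 * 1000 + 52) * n%:R ^+ 3 + (26 * 1000 + 856) * n%:R ^+ 2 +
    (20 * 1000 + 736) * n%:R) * hw R n 0 0 +
    (- 28 * n%:R ^+ 7 - 189 * n%:R ^+ 6 - 1345 * n%:R ^+ 5 - (7 * 1000 + 287) * n%:R ^+ 4 -
      (21 * 1000 + 55) * n%:R ^+ 3 - (45 * 1000 + 300) * n%:R ^+ 2 - (75 * 1000 +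
      132) * n%:R - (52 * 1000 + 704)) * hw R n 1 0) / ((n%:R + 2) ^+ 2 * (n%:R +
      3) ^+ 2 * (n%:R + 4) ^+ 2 * (n%:R + 5) * (n%:R + 6)).
Proof.
have swaps := (hwC R n 0 1, hwC R n 0 2, hwC R n 1 2, hwC R n 1 3, hwC R n 2 3).
have r : (n%:R + 4) * hw R n 4 2 +
    ((- n%:R + 11) * hw R n 3 2 + (- n%:R + 2) * hw R n 2 2 + 3 * hw R n 3 3 +
      3 * hw R n 3 1 + (n%:R + 4) * hw R n 4 1) = 0.
  by rewrite -[RHS](hw_rel1 R n 2 1) ?swaps; ring.
have n2 := natrD_neq0 R n 1; have n3 := natrD_neq0 R n 2; have n4 := natrD_neq0 R n 3;
  have n5 := natrD_neq0 R n 4; have n6 := natrD_neq0 R n 5.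
rewrite (solve_linear n4 r) hw33 hw41 hw32 hw31 hw22.
by field; rewrite n2 n3 n4 n5 n6.
Qed.

Lemma awalk21E (R : numFieldType) n : awalk R n (2, 1) =
  ((- 16 * n%:R ^+ 7 - 428 * n%:R ^+ 6 - (4 * 1000 + 780) * n%:R ^+ 5 - (28 * 1000 +
    724) * n%:R ^+ 4 - (89 * 1000 + 908) * n%:R ^+ 3 - (119 * 1000 + 456) * n%:R ^+ 2 -
    (2 * 1000 + 64) * n%:R + (86 * 1000 + 400)) * hw R n 0 0 +
   (16 * n%:R ^+ 7 + 452 * n%:R ^+ 6 + (5 * 1000 + 428) * n%:R ^+ 5 + (36 * 1000 +
     56) * n%:R ^+ 4 + (171 * 1000 + 736) * n%:R ^+ 3 + (551 * 1000 + 660) * n%:R ^+ 2 +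
     (933 * 1000 + 924) * n%:R + (592 * 1000 + 56)) * hw R n 1 0) /
  ((n%:R + 2) ^+ 2 * (n%:R + 3) ^+ 2 * (n%:R + 4) ^+ 2 * (n%:R + 5) ^+ 2 * (n%:R + 6)).
Proof.
have n2 := natrD_neq0 R n 1; have n3 := natrD_neq0 R n 2; have n4 := natrD_neq0 R n 3.
have n5 := natrD_neq0 R n 4; have n6 := natrD_neq0 R n 5.
rewrite awalk21 hw11 hw21 hw40 hw41 hw33 hw42 hw50 hw22.
by field; rewrite n2 n3 n4 n5 n6.
Qed.

(** Together with [hw00S], a first-order linear system for the coefficients at [(0, 0)] and
    [(1, 0)]. *)
Lemma hw10S (R : numFieldType) n : hw R n.+1 1 0 =
  ((2 * n%:R ^+ 2 + 6 * n%:R + 4) * hw R n 0 0 +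
   (7 * n%:R ^+ 2 + 18 * n%:R + 11) * hw R n 1 0) / (n%:R + 2) ^+ 2.
Proof.
have n2 := natrD_neq0 R n 1.
by rewrite hwS0 (hwC _ _ 0 1) hw20 hw11; field; rewrite n2.
Qed.

(** All three terms become combinations of the coefficients of [K^n] at [(0, 0)] and [(1, 0)], whose
    rational factors cancel. The index is shifted by one because [awalk] at time [n] gives
    [C3 (n + 1)]. *)
Lemma awalk21_rec (R : numFieldType) n :
  9 * (n%:R + 1) * (n%:R + 4) * awalk R n (2, 1)
  - 2 * (5 * (n%:R + 1) ^+ 2 + 32 * (n%:R + 1) + 42) * awalk R n.+1 (2, 1)
  + (n%:R + 8) * (n%:R + 7) * awalk R n.+2 (2, 1) = 0.
Proof.
have n2 := natrD_neq0 R n 1; have n3 := natrD_neq0 R n 2; have n4 := natrD_neq0 R n 3.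
have n5 := natrD_neq0 R n 4; have n6 := natrD_neq0 R n 5; have n7 := natrD_neq0 R n 6.
have n8 := natrD_neq0 R n 7.
have e k : n.+1%:R + k.+1%:R = n%:R + k.+2%:R :> R by rewrite -!natrD addSnnS.
have e' k : n.+2%:R + k.+1%:R = n%:R + k.+3%:R :> R by rewrite -!natrD !addSnnS.
rewrite !awalk21E !hw00S !hw10S !hw00S !(e, e').
by field; rewrite n2 n3 n4 n5 n6 n7 n8.
Qed.

(** Inverts the two by two system expressing consecutive alternating sums through the coefficients
    at [(0, 0)] and [(1, 0)]. The leading coefficients -4 and 4 do not cancel once the ratio of the
    two sums tends to 9. *)
Lemma hw00E (R : numFieldType) n :
  4 * ((295 * 1000 + 245)) * (n%:R + 1) * (n%:R + 2) * (n%:R + 3) * hw R n 0 0 =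
  (- 4 * n%:R ^+ 9 - 153 * n%:R ^+ 8 - (2 * 1000 + 553) * n%:R ^+ 7 - (24 * 1000 +
    381) * n%:R ^+ 6 - (209 * 1000 + 127) * n%:R ^+ 5 - (1404 * 1000 + 216) * n%:R ^+ 4 -
    ((5 * 1000 + 621) * 1000 + 792) * n%:R ^+ 3 - ((12 * 1000 + 129) * 1000 +
    354) * n%:R ^+ 2 - ((12 * 1000 + 942) * 1000 + 324) * n%:R - ((5 * 1000 + 347) * 1000 +
    296)) * awalk R n (2, 1) +
  (4 * n%:R ^+ 9 + 165 * n%:R ^+ 8 + (2 * 1000 + 994) * n%:R ^+ 7 + (31 * 1000 +
    401) * n%:R ^+ 6 + (217 * 1000 + 110) * n%:R ^+ 5 + (1074 * 1000 + 645) * n%:R ^+ 4 +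
    ((3 * 1000 + 829) * 1000 + 604) * n%:R ^+ 3 + ((8 * 1000 + 975) * 1000 +
    697) * n%:R ^+ 2 + ((11 * 1000 + 730) * 1000 + 384) * n%:R + ((6 * 1000 + 216) * 1000 +
    588)) * awalk R n.+1 (2, 1).
Proof.
have n2 := natrD_neq0 R n 1; have n3 := natrD_neq0 R n 2; have n4 := natrD_neq0 R n 3.
have n5 := natrD_neq0 R n 4; have n6 := natrD_neq0 R n 5; have n7 := natrD_neq0 R n 6.
have e k : n.+1%:R + k.+1%:R = n%:R + k.+2%:R :> R by rewrite -!natrD addSnnS.
rewrite !awalk21E hw00S hw10S !e.
by field; rewrite n2 n3 n4 n5 n6 n7.
Qed.

(** For the empty composition the polynomial has four monomials: the two on the axes contribute 0
    and the other two contribute equally, by antisymmetry. *)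
Lemma ncount_awalk (R : numDomainType) n : (ncount n.+1 [::])%:R = awalk R n (2, 1).
Proof.
have awall k i : awalk R k (0, i) = 0 by rewrite awalk_flip awalk_wall oppr0.
have := @ncount_lin2 R (fun n i j => awalk R n (i%:Z, j%:Z)) (@awalk0 R)
  (fun n i => awalk_wall R n i%:Z) (fun n i => awall n i%:Z) _ n [::].
rewrite big_nil; set x := 'X; set y := 'X%:P.
have -> : (x - y) * (x * y + x + y) * 1 =
  x * (x * (y * 1)) + x * (x * 1) - y * (y * (x * 1)) - y * (y * 1) by ring.
rewrite !lin2B lin2D !(lin2X, lin2Y) !lin2_1 awalk_wall awall subr0 addr0.
rewrite [awalk R n (1, 2)]awalk_flip opprK -mulr2n -[awalk _ _ _ *+ 2]mulr_natl.
move=> E; apply: (mulfI (_ : 2 != 0 :> R)); first by rewrite pnatr_eq0.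
apply: E => {}n i j; rewrite awalkS big_steps addr0 !big_cons !big_nil !ptD.
by rewrite !(posz1, poszN1, addr0) !addrA.
Qed.

Local Open Scope classical_set_scope.
Local Open Scope ring_scope.

(** * Wallis bounds *)

(** The primitive of [cos ^+ n] vanishing at 0, given by the reduction formula; its values at
    [pi / 2] are the Wallis integrals. *)
Fixpoint cos_prim (R : realType) (n : nat) : R -> R :=
  if n is n1.+1 then
    if n1 is n2.+1 then
      n%:R^-1 \*: (sin * cos ^+ n1 + n1%:R \*: @cos_prim R n2)
    else sin
  else id.

Lemma cos_primSS (R : realType) n : @cos_prim R n.+2 =
  n.+2%:R^-1 \*: (sin * cos ^+ n.+1 + n.+1%:R \*: cos_prim n).
Proof. by []. Qed.

Lemma is_derive_cos_prim (R : realType) n (x : R) :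
  is_derive x 1 (cos_prim n) (cos x ^+ n).
Proof.
have [m lenm] := ubnP n; elim: m n lenm => // m IH [|[|n]] lenm.
- exact: is_derive_id.
- by rewrite expr1; apply: is_derive_sin.
rewrite cos_primSS; have dF := IH n (ltn_trans (ltnSn n) lenm).
apply: is_derive_eq.
have n2 : n.+2%:R != 0 :> R by rewrite pnatr_eq0.
rewrite exprfctE /GRing.scale /=; apply: (canLR (mulKf n2)).
have -> : sin x * (n.+1%:R * cos x ^+ n * - sin x) = -
  n.+1%:R * cos x ^+ n * sin x ^+ 2 by ring.
by rewrite sin2cos2 !exprS -natr1; ring.
Qed.

Lemma cos_primSSE (R : realType) n (x : R) : cos_prim n.+2 x =
  n.+2%:R^-1 * (sin x * cos x ^+ n.+1 + n.+1%:R * cos_prim n x).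
Proof.
by have <- : (cos ^+ n.+1) x = cos x ^+ n.+1 by rewrite exprfctE.
Qed.

Lemma cos_prim0 (R : realType) n : @cos_prim R n 0 = 0.
Proof.
have [m lenm] := ubnP n; elim: m n lenm => // m IH [|[|n]] lenm //; first exact: sin0.
by rewrite cos_primSSE sin0 IH ?(ltn_trans (ltnSn n) lenm) // mul0r mulr0 addr0 mulr0.
Qed.

Lemma cos_prim_pihalfSS (R : realType) n :
  @cos_prim R n.+2 (pi / 2) = n.+1%:R / n.+2%:R * @cos_prim R n (pi / 2).
Proof.
by rewrite cos_primSSE cos_pihalf expr0n mulr0 add0r mulrA (mulrC _^-1).
Qed.

(** The difference of the two primitives has derivative [cos^n (1 - cos)], nonnegative between 0 and
    [pi / 2]. *)
Lemma cos_prim_pihalf_le (R : realType) n :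
  @cos_prim R n.+1 (pi / 2) <= @cos_prim R n (pi / 2).
Proof.
pose f : R -> R := cos_prim n - cos_prim n.+1.
have df (x : R) : is_derive x 1 f (cos x ^+ n - cos x ^+ n.+1).
  by apply: is_deriveB; apply: is_derive_cos_prim.
suff : f 0 <= f (pi / 2).
  by rewrite -[f 0]/(_ - _) -[f (pi / 2)]/(_ - _) !cos_prim0 subrr subr_ge0.
have pi0 : 0 <= pi / 2 :> R by rewrite divr_ge0 ?pi_ge0.
apply: (@ger0_derive1_ndecr R f 0 (pi / 2)) => //.
- move=> x; rewrite in_itv /= => /andP[x0 xpi]; rewrite derive1E derive_val exprSr.
  have c0 : 0 <= cos x by apply: cos_ge0_pihalf; rewrite (ltW xpi) andbT; lra.
  by rewrite -{1}[cos x ^+ n]mulr1 -mulrBr mulr_ge0 ?exprn_ge0 // subr_ge0 cos_le1.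
by apply: derivable_within_continuous.
Qed.

Definition wallis (R : realType) (j : nat) : R := 'C(j.*2, j)%:R / 4 ^+ j.

Lemma bin_center j : (j.+1 ^ 2 * 'C(j.+1.*2, j.+1) = j.*2.+2 * j.*2.+1 * 'C(j.*2, j))%N.
Proof.
rewrite expnS expn1 -mulnA -(mul_bin_diag j.*2.+2 j) /= mulnCA -mulnA; congr (_ * _)%N.
have -> : 'C(j.*2.+1, j) = 'C(j.*2.+1, j.+1) by rewrite -[RHS]bin_sub; [congr 'C(_, _)|]; lia.
by rewrite -(mul_bin_diag j.*2.+1 j).
Qed.

Lemma wallisS (R : realType) j : wallis R j.+1 = wallis R j * (j.*2.+1%:R / j.*2.+2%:R).
Proof.
have /(congr1 (fun k => k%:R : R)) := bin_center j; rewrite /wallis natrM natrX !natrM => e.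
have j1 : j.+1%:R != 0 :> R by rewrite pnatr_eq0.
have j2 : 4 ^+ j != 0 :> R by rewrite expf_neq0 ?pnatr_eq0.
have d2 : j.*2.+2%:R = 2 * j.+1%:R :> R by rewrite -doubleS -mul2n natrM.
have -> : 'C(j.+1.*2, j.+1)%:R = j.*2.+2%:R * j.*2.+1%:R * 'C(j.*2, j)%:R / j.+1%:R ^+ 2 :> R.
  by rewrite -e mulrAC divff ?mul1r // expf_neq0.
rewrite d2 (exprS 4 j); move: (4 ^+ j) (j.+1%:R) j1 j2 => a b b0 a0.
by field; rewrite a0 b0.
Qed.

Lemma wallis_gt0 (R : realType) j : 0 < wallis R j.
Proof. by rewrite divr_gt0 ?exprn_gt0 // ltr0n bin_gt0 -addnn leq_addr. Qed.

Lemma cos_prim_even (R : realType) j : @cos_prim R j.*2 (pi / 2) = wallis R j * (pi / 2).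
Proof.
elim: j => [|j IH]; first by rewrite /wallis bin0 expr0 divr1 mul1r.
by rewrite doubleS cos_prim_pihalfSS IH wallisS; ring.
Qed.

Lemma cos_prim_odd (R : realType) j :
  @cos_prim R j.*2.+1 (pi / 2) = (j.*2.+1%:R * wallis R j)^-1.
Proof.
elim: j => [|j IH]; first by rewrite /wallis bin0 expr0 divr1 mul1r invr1 -[LHS]/(sin _)
  sin_pihalf.
rewrite doubleS cos_prim_pihalfSS IH wallisS.
have nz k : k.+1%:R != 0 :> R by rewrite pnatr_eq0.
have := nz j.*2; have := nz j.*2.+1; have := nz j.*2.+2; have := lt0r_neq0 (wallis_gt0 R j).
move: (wallis R j) (j.*2.+1%:R) (j.*2.+2%:R) (j.*2.+3%:R) => w a b c w0 c0 b0 a0.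
by field; rewrite w0 a0 b0 c0.
Qed.

(** Compares the Wallis integrals of orders [2 j] and [2 j + 1]. *)
Lemma wallis_lower (R : realType) j : 1 <= pi * (j%:R + 1 / 2) * wallis R j ^+ 2.
Proof.
have := cos_prim_pihalf_le R j.*2; rewrite cos_prim_odd cos_prim_even.
have w0 := wallis_gt0 R j.
have d0 : 0 < j.*2.+1%:R * wallis R j by apply: mulr_gt0; rewrite ?ltr0Sn.
rewrite -[_^-1]mul1r ler_pdivrMr // => h; apply: le_trans h _.
by rewrite -[j.*2.+1%:R]natr1 -mul2n natrM le_eqVlt; apply/orP; left; apply/eqP; field.
Qed.

(** For [j > 0], comparing the Wallis integrals of orders [2 j - 1] and [2 j] gives the bound
    [1 / (pi j)]. It is weakened to denominators in [j + 1] in order to include [j = 0], where it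
    amounts to [pi <= 4]. *)
Lemma wallis_upper (R : realType) j :
  wallis R j ^+ 2 <= pi^-1 * (j.+1%:R^-1 + 3 / j.+1%:R ^+ 2).
Proof.
have pi0 := pi_gt0 R; rewrite mulrC ler_pdivlMr //; case: j => [|j].
  have -> : wallis R 0 = 1 by rewrite /wallis bin0 expr0 divr1.
  by rewrite !expr1n invr1; have := pihalf_lt2 R; lra.
have := cos_prim_pihalf_le R j.*2.+1; rewrite cos_prim_odd -doubleS cos_prim_even.
have w0 := wallis_gt0 R j.+1; have w0' := wallis_gt0 R j.
have -> : j.*2.+1%:R * wallis R j = 2 * j.+1%:R * wallis R j.+1.
  have j2 : j.*2.+2%:R != 0 :> R by rewrite pnatr_eq0.
  by rewrite wallisS -natrM mul2n -doubleS; move: (j.*2.+2%:R) j2 => b b0; field.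
have d0 : 0 < 2 * j.+1%:R * wallis R j.+1 by rewrite mulr_gt0 ?w0 // mulr_gt0 ?ltr0n.
rewrite -[(2 * _ * _)^-1]mul1r ler_pdivlMr // => h.
have j1 : 1 <= j.+1%:R :> R by rewrite ler1n.
rewrite -[j.+2%:R]natr1; move: h j1; move: (j.+1%:R) (wallis R j.+1) w0 => k w w0 h k1;
  have k0 : 0 < k by lra.
apply: (@le_trans _ _ k^-1).
  by rewrite -[_^-1]mul1r ler_pdivlMr //; apply: le_trans h; rewrite le_eqVlt; apply/orP;
    left; apply/eqP; field.
have -> : (k + 1)^-1 + 3 / (k + 1) ^+ 2 = k^-1 + (2 * k - 1) / (k * (k + 1) ^+ 2).
  by field; rewrite !lt0r_neq0 //; lra.
by rewrite lerDl divr_ge0 ?mulr_ge0 ?exprn_ge0 //; lra.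
Qed.

(** * Asymptotics of the constant term *)

(* With [z = s w], the bounds are [3 - 1/z^2 <= 2 z] and [2 z <= 1 + z^2]. *)
Lemma wsum_cvg (R : realType) (N : nat -> nat) (W w u v : nat -> nat -> R)
    (U V : nat -> R) (m s : R) : 0 < s ->
  (forall n j, 0 <= W n j) -> (forall n j, 0 < w n j) ->
  (forall n j, 1 <= u n j * w n j ^+ 2) -> (forall n j, w n j ^+ 2 <= v n j) ->
  (forall n, \sum_(j < N n) W n j * u n j <= U n) ->
  (forall n, \sum_(j < N n) W n j * v n j <= V n) ->
  (fun n => \sum_(j < N n) W n j) @ \oo --> m ->
  U @ \oo --> m * s ^+ 2 -> V @ \oo --> m / s ^+ 2 ->
  (fun n => \sum_(j < N n) W n j * w n j) @ \oo --> m / s.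
Proof.
move=> s0 W0 w0 uw wv WU WV cW cU cV.
apply: (@squeeze_cvgr _ _ _ _
  (fun n => (3 * (\sum_(j < N n) W n j) - U n / s ^+ 2) / (2 * s))
  (fun n => ((\sum_(j < N n) W n j) / s + V n * s) / 2)).
- near=> n; apply/andP; split.
    apply: (@le_trans _ _ (\sum_(j < N n) W n j * ((3 - u n j / s ^+ 2) / (2 * s)))).
      rewrite [leRHS](_ : _ = (3 * (\sum_(j < N n) W n j) -
        (\sum_(j < N n) W n j * u n j) / s ^+ 2) / (2 * s)); last first.
        rewrite mulr_sumr !mulr_suml -sumrB mulr_suml.
        by apply: eq_bigr => j _; ring.
      by rewrite ler_pM2r ?invr_gt0 ?mulr_gt0 // lerB // ler_pM2r ?invr_gt0 ?exprn_gt0.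
    apply: ler_sum => j _; apply: ler_wpM2l => //.
    have := uw n j; have := w0 n j; move: (w n j) (u n j) => x y x0 yx.
    have z0 : 0 < s * x by rewrite mulr_gt0.
    have h1 : (s * x) ^- 2 <= y / s ^+ 2.
      rewrite exprMn invfM mulrC ler_pM2r ?invr_gt0 ?exprn_gt0 //.
      by rewrite -[_^-1]mul1r ler_pdivrMr ?exprn_gt0.
    have h2 : 3 - (s * x) ^- 2 <= 2 * (s * x).
      rewrite -subr_ge0 (_ : _ - _ = (s * x - 1) ^+ 2 * (2 * (s * x) + 1) / (s * x) ^+ 2).
        by apply: divr_ge0 (sqr_ge0 _); apply: mulr_ge0 (sqr_ge0 _) _; lra.
      by field; rewrite !lt0r_neq0.
    by rewrite ler_pdivrMr ?mulr_gt0 //; lra.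
  apply: (@le_trans _ _ (\sum_(j < N n) W n j * ((s^-1 + v n j * s) / 2))).
    apply: ler_sum => j _; apply: ler_wpM2l => //.
    have := wv n j; move: (w n j) (v n j) => x y xy.
    have h1 : 2 * x <= s^-1 + x ^+ 2 * s.
      rewrite -subr_ge0 (_ : _ - _ = (s * x - 1) ^+ 2 / s).
        by rewrite mulr_ge0 ?invr_ge0 ?sqr_ge0 // ltW.
      by field; rewrite lt0r_neq0.
    have h2 : x ^+ 2 * s <= y * s by rewrite ler_pM2r.
    by lra.
  rewrite [leLHS](_ : _ = ((\sum_(j < N n) W n j) / s +
      (\sum_(j < N n) W n j * v n j) * s) / 2); last first.
    by rewrite !mulr_suml -big_split mulr_suml; apply: eq_bigr => j _ /=; ring.
  by rewrite ler_pM2r ?invr_gt0 // lerD2l ler_pM2r.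
- rewrite [X in _ --> X](_ : _ = (3 * m - m * s ^+ 2 / s ^+ 2) / (2 * s)); last first.
    by field; rewrite lt0r_neq0.
  apply: cvgM; last exact: cvg_cst.
  apply: cvgB; first by apply: cvgM cW; apply: cvg_cst.
  by apply: cvgM => //; apply: cvg_cst.
rewrite [X in _ --> X](_ : _ = (m / s + m / s ^+ 2 * s) / 2); last first.
  by field; rewrite lt0r_neq0.
apply: cvgM; last exact: cvg_cst.
by apply: cvgD; apply: cvgM => //; apply: cvg_cst.
Unshelve. all: by end_near.
Qed.

(** * Moments of the binomial weights and limits of the weighted sums *)

Definition binsq (R : comNzRingType) n : R := \sum_(j < n.+1) 'C(n, j)%:R ^+ 2 * 4 ^+ j.

Definition bin45 (R : comNzRingType) n m : R := 'C(n, m)%:R * 4 ^+ m * 5 ^+ (n - m).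

Lemma coef_CDXn (R : comNzRingType) (a : R) d n k : (0 < d)%N ->
  ((a%:P + 'X^d) ^+ n)`_k = if (d %| k)%N then a ^+ (n - k %/ d) *+ 'C(n, k %/ d) else 0.
Proof.
move=> d0; rewrite exprDn coef_sum.
under eq_bigr do rewrite coefMn -rmorphXn -exprM coefCM coefXn.
case: ifPn => [/dvdnP[i ->]|ndk].
  rewrite mulnK //; have [ltin|] := ltnP i n.+1.
    rewrite (bigD1 (Ordinal ltin)) //= mulnC eqxx mulr1 big1 ?addr0 // => j ij.
    rewrite eqn_pmul2l // eq_sym (_ : (j == i :> nat) = false) ?mulr0 ?mul0rn //.
    by apply/negbTE; apply: contra ij => /eqP e; apply/eqP/val_inj.
  move=> ltni; rewrite bin_small // mulr0n big1 // => j _.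
  rewrite mulnC eqn_pmul2l // (_ : (i == j :> nat) = false) ?mulr0 ?mul0rn //.
  by apply/negbTE; rewrite neq_ltn orbC (leq_trans (ltn_ord j) ltni).
apply: big1 => j _; rewrite (_ : (k == d * j)%N = false) ?mulr0 ?mul0rn //.
by apply/negbTE; apply: contra ndk => /eqP ->; rewrite dvdn_mulr.
Qed.

(* Compare the coefficients of [X^n] in
   [((1 + X)(4 + X))^n = (5 X + (4 + X^2))^n]. *)
Lemma binsq_central (R : realType) n :
  binsq R n = \sum_(m < n.+1) (~~ odd m)%:R * (bin45 R n m * wallis R m./2).
Proof.
have e : ((1%:P + 'X^1) * (4%:P + 'X^1)) ^+ n =
         (5%:P * 'X^1 + (4%:P + 'X^2)) ^+ n :> {poly R}.
  by congr (_ ^+ n); rewrite !polyC_natr polyC1 !expr1; ring.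
have := congr1 (fun p : {poly R} => p`_n) e; rewrite exprMn coefM => {}e.
transitivity (\sum_(j < n.+1) ((1%:P + 'X^1) ^+ n : {poly R})`_j *
    ((4%:P + 'X^1) ^+ n)`_(n - j)).
  apply: eq_bigr => -[j /= ltj] _; rewrite ltnS in ltj.
  rewrite !coef_CDXn // !dvd1n !divn1 subKn // bin_sub // expr1n.
  by rewrite -[4 ^+ j *+ _]mulr_natr; ring.
rewrite e exprDn coef_sum; apply: eq_bigr => -[m /= ltm] _; rewrite ltnS in ltm.
rewrite coefMn exprMn -rmorphXn expr1 -mulrA coefCM coefXnM ltnNge leq_subr /= subKn //.
rewrite coef_CDXn // dvdn2; case: ifP => [/negPf om|]; last first.
  by move=> _; rewrite mulr0 mul0rn mul0r.
have em : m = (m./2 + m./2)%N by rewrite addnn -[LHS]odd_double_half om.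
rewrite mul1r /bin45 /wallis divn2 -addnn -em.
have h4 : 4 ^+ m = 4 ^+ m./2 * 4 ^+ m./2 :> R by rewrite -exprD -em.
have -> : (m - m./2 = m./2)%N by rewrite {1}em addnK.
have n4 : 4 ^+ m./2 != 0 :> R by rewrite expf_neq0 ?pnatr_eq0.
rewrite h4 -mulr_natr -[_ *+ 'C(m, _)]mulr_natr.
by move: (4 ^+ m./2) n4 => x x0; field.
Qed.

Lemma bin45S (R : comNzRingType) n m :
  m.+1%:R * bin45 R n.+1 m.+1 = 4 * n.+1%:R * bin45 R n m.
Proof.
have := congr1 (fun k => k%:R : R) (mul_bin_diag n.+1 m); rewrite !natrM /= => e.
by rewrite /bin45 subSS exprS !mulrA -e; ring.
Qed.

(** Half the sum or half the difference of the expansions of [(5 + 4)^n] and [(5 - 4)^n]. *)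
Lemma bin45_parity (R : realType) n (b : bool) :
  \sum_(m < n.+1) (odd m == b)%:R * bin45 R n m = (9 ^+ n + (-1) ^+ b) / 2.
Proof.
have e1 : \sum_(m < n.+1) bin45 R n m = 9 ^+ n.
  rewrite (_ : 9 = 5 + 4) ?exprDn; last by ring.
  by apply: eq_bigr => i _; rewrite /bin45 -[_ *+ 'C(n, i)]mulr_natr; ring.
have e2 : \sum_(m < n.+1) (-1) ^+ m * bin45 R n m = 1.
  have e41 : 5 - 4 = 1 :> R by ring.
  rewrite -[RHS](expr1n _ n) -[X in _ = X ^+ n]e41 exprDn; apply: eq_bigr => i _;
    rewrite /bin45 (exprNn 4) -[RHS]mulr_natr.
  by move: (5 ^+ _) (4 ^+ _) ((-1) ^+ _) => x y z; ring.
have -> : 9 ^+ n + (-1) ^+ b =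
    \sum_(m < n.+1) (1 + (-1) ^+ b * (-1) ^+ m) * bin45 R n m.
  under eq_bigr do rewrite mulrDl mul1r -mulrA.
  by rewrite big_split -mulr_sumr /= e1 e2 mulr1.
rewrite mulr_suml; apply: eq_bigr => m _ /=; rewrite -[(-1) ^+ m]signr_odd.
by case: (odd m) b => -[]; rewrite /= ?expr0 ?expr1; field.
Qed.

Lemma bin45_ge0 (R : realType) n m : 0 <= bin45 R n m.
Proof. by rewrite !mulr_ge0 ?exprn_ge0. Qed.

Lemma bin45_even_sum (R : realType) n :
  \sum_(m < n.+1) (~~ odd m)%:R * bin45 R n m = (9 ^+ n + 1) / 2.
Proof.
by rewrite -[X in _ + X](expr0 (-1)) -(bin45_parity R n false); apply: eq_bigr => m _;
  case: odd.
Qed.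

Lemma bin45_odd_sum (R : realType) n :
  \sum_(m < n.+1) (odd m)%:R * bin45 R n m = (9 ^+ n - 1) / 2.
Proof.
by rewrite -[X in _ + X](expr1 (-1)) -(bin45_parity R n true); apply: eq_bigr => m _; case: odd.
Qed.

(** The factor [m] is absorbed by the shift [bin45S], which turns even indices into odd ones. *)
Lemma bin45_even_mean (R : realType) n :
  \sum_(m < n.+2) (~~ odd m)%:R * bin45 R n.+1 m * m%:R = 2 * n.+1%:R * (9 ^+ n - 1).
Proof.
rewrite big_ord_recl mulr0 add0r.
transitivity (\sum_(m < n.+1) 4 * n.+1%:R * ((odd m)%:R * bin45 R n m)).
  by apply: eq_bigr => m _; rewrite /= negbK -mulrA -[bin45 _ _ _ * _]mulrC bin45S; ring.
by rewrite -mulr_sumr bin45_odd_sum; field.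
Qed.

Lemma bin45_even_inv (R : realType) n :
  \sum_(m < n.+1) (~~ odd m)%:R * bin45 R n m / m.+1%:R =
  (9 ^+ n.+1 - 1) / (8 * n.+1%:R).
Proof.
have n0 : n.+1%:R != 0 :> R by rewrite pnatr_eq0.
have -> : (9 ^+ n.+1 - 1) / (8 * n.+1%:R) = (9 ^+ n.+1 - 1) / 2 / (4 * n.+1%:R) :> R.
  by move: (n.+1%:R) n0 (9 ^+ _) => x x0 y; field.
rewrite -bin45_odd_sum [in RHS]big_ord_recl mul0r add0r mulr_suml; apply: eq_bigr => m _.
have m0 : m.+1%:R != 0 :> R by rewrite pnatr_eq0.
have := bin45S R n m; move: (bin45 R n.+1 _) (bin45 R n m) => y x e.
apply: (mulIf m0); rewrite mulfVK // [in RHS]mulrAC -(mulrA _ y) (mulrC y) e.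
by move: (n.+1%:R) n0 => z z0; field.
Qed.

(** Two shifts turn the sum into a multiple of the expansion of [9^(n + 2)] without its first two
    terms. *)
Lemma bin45_inv2 (R : realType) n :
  \sum_(m < n.+1) bin45 R n m / (m.+1%:R * m.+2%:R) <=
  9 ^+ n.+2 / (16 * n.+1%:R * n.+2%:R).
Proof.
have e1 : \sum_(m < n.+3) bin45 R n.+2 m = 9 ^+ n.+2.
  rewrite (_ : 9 = 5 + 4) ?exprDn; last by ring.
  apply: eq_bigr => i _; rewrite /bin45 -[RHS]mulr_natr.
  by move: (5 ^+ _) (4 ^+ _) => x y; ring.
rewrite -e1 [in leRHS]big_ord_recl [in leRHS]big_ord_recl addrA mulrDl mulr_suml -[leLHS]add0r.
apply: lerD; first by rewrite divr_ge0 ?addr_ge0 ?bin45_ge0 ?mulr_ge0.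
apply: ler_sum => m _; rewrite le_eqVlt; apply/orP; left; apply/eqP => /=.
have nz k : k.+1%:R != 0 :> R by rewrite pnatr_eq0.
have := bin45S R n m; have := bin45S R n.+1 m.+1.
rewrite /bump /= !add1n.
move: (nz m) (nz m.+1) (nz n) (nz n.+1) (bin45 R n.+2 m.+2) (bin45 R n.+1 m.+1) (bin45 R n m).
move: (m.+1%:R) (m.+2%:R) (n.+1%:R) (n.+2%:R) => a b c d a0 b0 c0 d0 x y z e2 e3.
have -> : x = 4 * d * y / b by rewrite -e2 mulrAC divff ?mul1r.
have -> : y = 4 * c * z / a by rewrite -e3 mulrAC divff ?mul1r.
by field; rewrite a0 b0 c0 d0.
Qed.

Lemma cvg_natV (R : realType) (c : R) : (fun n => c / n.+1%:R) @ \oo --> 0.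
Proof. by rewrite -[0](mulr0 c); apply: cvgM; [exact: cvg_cst|exact: cvg_harmonic]. Qed.

Lemma cvg_expV9 (R : realType) : (fun n => (9 ^+ n)^-1 : R) @ \oo --> 0.
Proof.
rewrite [X in X @ _](_ : _ = (fun n => 9^-1 ^+ n)); last by apply/funext => n; rewrite exprVn.
by apply: cvg_expr; rewrite ger0_norm ?invr_ge0 // invf_lt1 ?ltr1n.
Qed.

(** Under the weights [bin45] the index [m] has mean about [4 n / 9], and [wallis m./2] behaves like
    [1 / sqrt (pi m / 2)]; hence [s^2 = 2 pi / 9]. The factor [1 / 2] is the limiting share of the
    even indices. *)
Lemma binsq_cvg (R : realType) :
  (fun n => Num.sqrt n.+1%:R * binsq R n.+1 / 9 ^+ n.+1) @ \oo -->
  1 / 2 / Num.sqrt (2 * pi / 9).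
Proof.
have pi0 := pi_gt0 R; set s := Num.sqrt _.
have s2 : s ^+ 2 = 2 * pi / 9 by rewrite sqr_sqrtr //; lra.
have s0 : 0 < s by rewrite sqrtr_gt0; lra.
rewrite [X in X @ _](_ : _ = fun n => \sum_(m < n.+2)
   ((~~ odd m)%:R * bin45 R n.+1 m / 9 ^+ n.+1) * (Num.sqrt n.+1%:R * wallis R m./2));
     last first.
  apply/funext => n; rewrite binsq_central mulr_sumr mulr_suml.
  by apply: eq_bigr => m _; move: (9 ^+ _) (Num.sqrt _) => x y; ring.
apply: (@wsum_cvg R (fun n => n.+2)
  (fun n m => (~~ odd m)%:R * bin45 R n.+1 m / 9 ^+ n.+1)
  (fun n m => Num.sqrt n.+1%:R * wallis R m./2)
  (fun n m => pi * (m%:R + 1) / (2 * n.+1%:R))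
  (* As [m./2 + 1 >= (m + 1) / 2], the term [3 / (m./2 + 1)^2] of [wallis_upper] is at most
     [12 / (m + 1)^2], hence at most [24 / ((m + 1) (m + 2))], a form that [bin45_inv2] can sum. *)
  (fun n m => n.+1%:R / pi * (2 / m.+1%:R + 24 / (m.+1%:R * m.+2%:R)))
  (fun n => pi / 9 + pi / 2 / n.+1%:R)
  (* 122 is [24 * 81 / 16] rounded up. *)
  (fun n => (9 / 4 + 122 / n.+1%:R) / pi) (1 / 2) s) => //.
- by move=> n m; rewrite !mulr_ge0 ?bin45_ge0 ?invr_ge0 ?exprn_ge0.
- by move=> n m; rewrite mulr_gt0 ?wallis_gt0 ?sqrtr_gt0 ?ltr0n.
- move=> n m; rewrite exprMn sqr_sqrtr //.
  apply: le_trans (wallis_lower R m./2) _.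
  have -> : pi * (m%:R + 1) / (2 * n.+1%:R) * (n.+1%:R * wallis R m./2 ^+ 2) =
            pi * ((m%:R + 1) / 2) * wallis R m./2 ^+ 2.
    have : n.+1%:R != 0 :> R by rewrite pnatr_eq0.
    by move: (n.+1%:R) => x x0; field.
  rewrite ler_pM2r ?exprn_gt0 ?wallis_gt0 // ler_pM2l //.
  have : (m./2.*2%:R <= m%:R :> R) by rewrite ler_nat -[leqRHS]odd_double_half leq_addl.
  by rewrite -mul2n natrM; lra.
- move=> n m; rewrite exprMn sqr_sqrtr // -mulrA ler_pM2l ?ltr0n //.
  apply: le_trans (wallis_upper R m./2) _; rewrite ler_pM2l ?invr_gt0 //.
  have le_k : m.+1%:R / 2 <= m./2.+1%:R :> R.
    rewrite ler_pdivrMr // -natrM ler_nat muln2 doubleS -[in leqLHS](odd_double_half m).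
    by case: odd; rewrite ?add0n ?add1n.
  have m1 : 0 < m.+1%:R / 2 :> R by rewrite divr_gt0.
  have k0 : 0 < m./2.+1%:R :> R by rewrite ltr0n.
  have h1 : (m./2.+1%:R)^-1 <= 2 / m.+1%:R :> R.
    by rewrite -[leRHS]invf_div lef_pV2.
  have h2 : (m./2.+1%:R ^+ 2)^-1 <= 4 / (m.+1%:R ^+ 2) :> R.
    have -> : 4 / (m.+1%:R ^+ 2) = ((m.+1%:R / 2) ^+ 2)^-1 :> R.
      by rewrite -invf_div expr_div_n; congr (_ / _)^-1; ring.
    by rewrite lef_pV2 ?posrE ?exprn_gt0 // ler_pXn2r // nnegrE ltW.
  have h3 : (m.+1%:R ^+ 2)^-1 <= 2 / (m.+1%:R * m.+2%:R) :> R.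
    rewrite ler_pdivlMr ?mulr_gt0 ?ltr0n // expr2 invfM -mulrA mulKf ?pnatr_eq0 //.
    by rewrite mulrC ler_pdivrMr ?ltr0n // -natrM ler_nat; lia.
  move: h1 h2 h3; move: (_ ^-1) (_ ^-1) (_ ^-1) (_ ^-1) (_ ^-1).
  by move=> a b c d e h1 h2 h3; lra.
- move=> n; rewrite (_ : \sum_(_ < _) _ = pi / (2 * n.+1%:R * 9 ^+ n.+1) *
      (2 * n.+1%:R * (9 ^+ n - 1) + (9 ^+ n.+1 + 1) / 2)); last first.
    rewrite -bin45_even_mean -bin45_even_sum -big_split mulr_sumr; apply: eq_bigr => m _ /=.
    have : n.+1%:R != 0 :> R by rewrite pnatr_eq0.
    have : 9 ^+ n.+1 != 0 :> R by rewrite expf_neq0 ?pnatr_eq0.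
    by move: (9 ^+ n.+1) (n.+1%:R) => x y x0 y0; field; rewrite x0 y0.
  have y1 : 0 < n.+1%:R :> R by rewrite ltr0n.
  have x1 : 1 <= 9 ^+ n :> R by rewrite exprn_ege1 ?ler1n.
  rewrite exprS; move: (9 ^+ n) (n.+1%:R) x1 y1 => x y x1 y0.
  rewrite -subr_ge0 (_ : _ - _ = pi * (4 * y + 9 * x - 1) / (36 * x * y)).
    by rewrite divr_ge0 ?mulr_ge0 //; lra.
  by field; rewrite !lt0r_neq0 //; lra.
- move=> n; set y : R := n.+1%:R; set x : R := 9 ^+ n.+1.
  have y0 : 0 < y by rewrite ltr0n.
  have x1 : 1 <= x by rewrite exprn_ege1 ?ler1n.
  have xpi : 0 < y / (pi * x) by rewrite divr_gt0 ?mulr_gt0 //; lra.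
  apply: (@le_trans _ _ (y / (pi * x) * (2 * ((9 * x - 1) / (8 * (y + 1))) +
      24 * (81 * x / (16 * (y + 1) * (y + 2)))))); last first.
    have hA : y / x * (2 * ((9 * x - 1) / (8 * (y + 1)))) <= 9 / 4.
      rewrite -subr_ge0 (_ : _ - _ = (9 * x + y) / (4 * x * (y + 1))).
        by rewrite divr_ge0 ?mulr_ge0 //; lra.
      by field; rewrite !lt0r_neq0 //; lra.
    have hB : y / x * (24 * (81 * x / (16 * (y + 1) * (y + 2)))) <= 122 / y.
      rewrite -subr_ge0 (_ : _ - _ = (y * y + 732 * y + 488) / (2 * y * (y + 1) * (y + 2))).
        by rewrite divr_ge0 ?mulr_ge0 ?addr_ge0 ?mulr_ge0 //; lra.
      by field; rewrite !lt0r_neq0 //; lra.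
    have -> : y / (pi * x) = y / x / pi by rewrite invfM; ring.
    by rewrite mulrAC ler_pM2r ?invr_gt0 // mulrDr lerD.
  have eX : 9 ^+ n.+2 = 9 * x by rewrite exprS.
  have eX' : 9 ^+ n.+3 = 81 * x by rewrite exprS eX; ring.
  have eY : n.+2%:R = y + 1 by rewrite -natr1.
  have eY' : n.+3%:R = y + 2 by rewrite -natr1 eY; ring.
  rewrite -eX -eY -eX' -eY' -bin45_even_inv.
  apply: (@le_trans _ _ (y / (pi * x) * (2 * (\sum_(m < n.+2) (~~ odd m)%:R * bin45 R n.+1 m /
    m.+1%:R) +
     24 * (\sum_(m < n.+2) bin45 R n.+1 m / (m.+1%:R * m.+2%:R))))); last first.
    by rewrite ler_pM2l // lerD2l ler_pM2l // bin45_inv2.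
  rewrite !mulr_sumr -big_split mulr_sumr; apply: ler_sum => m _ /=.
  have -> : (~~ odd m)%:R * bin45 R n.+1 m / x * (y / pi * (2 / m.+1%:R +
    24 / (m.+1%:R * m.+2%:R))) =
    y / (pi * x) * (2 * ((~~ odd m)%:R * bin45 R n.+1 m / m.+1%:R) +
      24 * ((~~ odd m)%:R * bin45 R n.+1 m / (m.+1%:R * m.+2%:R))).
    rewrite (invfM pi x); ring.
  rewrite ler_pM2l // lerD2l ler_pM2l // ler_pM2r ?invr_gt0 ?mulr_gt0 ?ltr0n //.
  by rewrite ler_piMl ?bin45_ge0 // lern1 leq_b1.
- rewrite [X in X @ _](_ : _ = fun n => 1 / 2 + (9 ^+ n)^-1 / 18); last first.
    apply/funext => n; rewrite -mulr_suml bin45_even_sum exprS.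
    have : 9 ^+ n != 0 :> R by rewrite expf_neq0 ?pnatr_eq0.
    by move: (9 ^+ n) => x x0; field.
  rewrite [X in _ --> X](_ : _ = 1 / 2 + 0 / 18); last by field.
  apply: cvgD; first exact: cvg_cst.
  by apply: cvgM; [exact: cvg_expV9|exact: cvg_cst].
- rewrite s2 [X in _ --> X](_ : _ = pi / 9 + 0); last by field.
  by apply: cvgD; [exact: cvg_cst|exact: cvg_natV].
rewrite s2 [X in _ --> X](_ : _ = (9 / 4 + 0) / pi); last first.
  by move: (pi) pi0 => p p0; field; rewrite lt0r_neq0.
by apply: cvgM; [apply: cvgD; [exact: cvg_cst|exact: cvg_natV]|exact: cvg_cst].
Qed.

Lemma binsq_ge0 (R : realType) n : 0 <= binsq R n.
Proof. by apply: sumr_ge0 => j _; rewrite mulr_ge0 ?exprn_ge0 ?sqr_ge0. Qed.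

(** With [N = n + 1], squared binomials absorb [j^2] and [(N - j)^2] exactly; the difference of
    these squares is affine in [j] and yields the first moment. *)
Lemma binsq_mean (R : realType) n :
  \sum_(j < n.+2) 'C(n.+1, j)%:R ^+ 2 * 4 ^+ j * j%:R =
  n.+1%:R * (binsq R n.+1 + 3 * binsq R n) / 2.
Proof.
have n0 : n.+1%:R != 0 :> R by rewrite pnatr_eq0.
have e2 : \sum_(j < n.+2) 'C(n.+1, j)%:R ^+ 2 * 4 ^+ j * j%:R ^+ 2 =
    4 * n.+1%:R ^+ 2 * binsq R n.
  rewrite big_ord_recl /= expr0n mulr0 add0r mulr_sumr; apply: eq_bigr => j _ /=.
  have := congr1 (fun k => k%:R : R) (mul_bin_diag n.+1 j); rewrite !natrM /= => e.
  rewrite /bump /= add1n (exprS 4); move: (4 ^+ j) => x.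
  transitivity (4 * x * (j.+1%:R * 'C(n.+1, j.+1)%:R) ^+ 2); first by ring.
  by rewrite -e; ring.
have e3 : \sum_(j < n.+2) 'C(n.+1, j)%:R ^+ 2 * 4 ^+ j * (n.+1%:R - j%:R) ^+ 2 =
    n.+1%:R ^+ 2 * binsq R n.
  rewrite big_ord_recr /= subrr expr0n mulr0 addr0 mulr_sumr; apply: eq_bigr => j _ /=.
  have := congr1 (fun k => k%:R : R) (mul_bin_down n.+1 j); rewrite !natrM /= => e.
  rewrite natrB in e; last by rewrite ltnW.
  by rewrite mulrAC -exprMn (mulrC 'C(_, _)%:R) -e; ring.
rewrite (_ : n.+1%:R * _ / 2 =
  (n.+1%:R ^+ 2 * binsq R n.+1 - n.+1%:R ^+ 2 * binsq R n + 4 * n.+1%:R ^+ 2 * binsq R n) /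
    (2 * n.+1%:R)); last by move: (n.+1%:R) n0 => x x0; field.
rewrite -e2 -e3 mulr_sumr -sumrB -big_split mulr_suml; apply: eq_bigr => j _ /=.
by move: (n.+1%:R) n0 => x x0; field.
Qed.

Lemma binsq_inv2 (R : realType) n :
  \sum_(j < n.+1) 'C(n, j)%:R ^+ 2 * 4 ^+ j / j.+1%:R ^+ 2 <=
  binsq R n.+1 / (4 * n.+1%:R ^+ 2).
Proof.
have n0 : n.+1%:R != 0 :> R by rewrite pnatr_eq0.
rewrite /binsq [in leRHS]big_ord_recl mulrDl mulr_suml -[leLHS]add0r; apply: lerD.
  by rewrite divr_ge0 ?mulr_ge0 ?exprn_ge0.
apply: ler_sum => j _; rewrite le_eqVlt; apply/orP; left; apply/eqP => /=.
have j0 : j.+1%:R != 0 :> R by rewrite pnatr_eq0.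
have := congr1 (fun k => k%:R : R) (mul_bin_diag n.+1 j); rewrite !natrM /= => e.
rewrite /bump /= add1n (_ : 'C(n.+1, j.+1)%:R = n.+1%:R * 'C(n, j)%:R / j.+1%:R :> R).
  by rewrite (exprS 4); move: (n.+1%:R) n0 (j.+1%:R) j0 => x x0 y y0; field; rewrite x0 y0.
by rewrite e mulrAC divff ?mul1r.
Qed.

Definition bin2sum (R : comNzRingType) n : R :=
  \sum_(j < n.+1) 'C(n, j)%:R ^+ 2 * 'C(j.*2, j)%:R.

Lemma bin2sumE (R : realType) n :
  bin2sum R n = \sum_(j < n.+1) 'C(n, j)%:R ^+ 2 * 4 ^+ j * wallis R j.
Proof.
apply: eq_bigr => j _; rewrite /wallis.
have : 4 ^+ j != 0 :> R by rewrite expf_neq0 ?pnatr_eq0.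
by move: (4 ^+ j) => x x0; field.
Qed.

(** The weights [C(n, j)^2 4^j] have mean index about [2 n / 3], and [wallis j] behaves like
    [1 / sqrt (pi j)]; hence [s^2 = 2 pi / 3]. The normalized total weights are the terms of [a],
    with limit [m]. *)
Lemma bin2sum_cvg (R : realType) :
  (fun n => n.+2%:R * bin2sum R n.+2 / 9 ^+ n.+2) @ \oo -->
  1 / 2 / Num.sqrt (2 * pi / 9) / Num.sqrt (2 * pi / 3).
Proof.
have pi0 := pi_gt0 R; set s := Num.sqrt (2 * pi / 3).
have s2 : s ^+ 2 = 2 * pi / 3 by rewrite sqr_sqrtr //; lra.
have s0 : 0 < s by rewrite sqrtr_gt0; lra.
move: (1 / 2 / _) (@binsq_cvg R) => m cm.
pose a n : R := Num.sqrt n.+1%:R * binsq R n.+1 / 9 ^+ n.+1.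
have ca : a @ \oo --> m := cm.
have ca1 : (fun n => a n.+1) @ \oo --> m by rewrite (cvg_shiftS a).
have ca2 : (fun n => a n.+2) @ \oo --> m by rewrite (cvg_shiftS (fun n => a n.+1)).
have a0 n : 0 <= a n by rewrite divr_ge0 ?mulr_ge0 ?sqrtr_ge0 ?binsq_ge0 ?exprn_ge0.
have cV2 c : (fun n => c / n.+2%:R) @ \oo --> (0 : R).
  by rewrite (cvg_shiftS (fun n => c / n.+1%:R)); apply: cvg_natV.
rewrite [X in X @ _](_ : _ = fun n => \sum_(j < n.+3)
   (Num.sqrt n.+2%:R * ('C(n.+2, j)%:R ^+ 2 * 4 ^+ j) / 9 ^+ n.+2) *
   (Num.sqrt n.+2%:R * wallis R j)); last first.
  apply/funext => n; rewrite bin2sumE mulr_sumr mulr_suml; apply: eq_bigr => j _.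
  rewrite -{1}[n.+2%:R]sqr_sqrtr //.
  by move: (9 ^+ _) (Num.sqrt _) (4 ^+ _) => x y z; ring.
apply: (@wsum_cvg R (fun n => n.+3)
  (fun n j => Num.sqrt n.+2%:R * ('C(n.+2, j)%:R ^+ 2 * 4 ^+ j) / 9 ^+ n.+2)
  (fun n j => Num.sqrt n.+2%:R * wallis R j)
  (fun n j => pi * (j%:R + 1 / 2) / n.+2%:R)
  (fun n j => n.+2%:R / pi * (j.+1%:R^-1 + 3 / j.+1%:R ^+ 2))
  (fun n => pi * ((a n.+1 + a n / 3 * (1 + 1 / n.+1%:R)) / 2 + a n.+1 * (1 / 2 / n.+2%:R)))
  (fun n => (3 / 4 * a n.+1 + 9 * a n.+2 * (1 / 12 + 3 / 4 / n.+2%:R)) / pi) m s) => //.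
- move=> n j; apply: divr_ge0; last exact: exprn_ge0.
  by apply: mulr_ge0; [exact: sqrtr_ge0|rewrite mulr_ge0 ?exprn_ge0 ?sqr_ge0].
- by move=> n j; rewrite mulr_gt0 ?wallis_gt0 ?sqrtr_gt0 ?ltr0n.
- move=> n j; rewrite exprMn sqr_sqrtr //.
  apply: le_trans (wallis_lower R j) _; rewrite le_eqVlt; apply/orP; left; apply/eqP.
  have : n.+2%:R != 0 :> R by rewrite pnatr_eq0.
  by move: (n.+2%:R) (pi) => x p x0; field.
- move=> n j; rewrite exprMn sqr_sqrtr // -mulrA ler_pM2l ?ltr0n //.
  exact: wallis_upper.
- move=> n; set y : R := n.+1%:R; set q : R := 9 ^+ n.+1; set r := Num.sqrt n.+2%:R.
  have y0 : 0 < y by rewrite ltr0n.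
  have q0 : 0 < q by rewrite exprn_gt0.
  have eM : n.+2%:R = y + 1 by rewrite -[LHS]natr1.
  rewrite (_ : \sum_(_ < _) _ = r / (9 * q) * (pi / n.+2%:R) *
      (\sum_(j < n.+3) 'C(n.+2, j)%:R ^+ 2 * 4 ^+ j * j%:R + binsq R n.+2 / 2)); last first.
    rewrite [in RHS]/binsq mulr_suml -big_split mulr_sumr; apply: eq_bigr => j _ /=.
    by rewrite -/r exprS -/q (invfM 9 q); move: (4 ^+ j) (q^-1) (n.+2%:R^-1) => x1 x2 x3; field.
  rewrite binsq_mean /a -/r -/y (exprS 9 n.+1) -/q eM; clearbody y q.
  (* Trades [sqrt (n + 2)] for [sqrt (n + 1)], the factor contained in [a n]. *)
  have rS : r <= Num.sqrt y * (1 + 1 / y).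
    have -> : Num.sqrt y * (1 + 1 / y) = Num.sqrt (y * (1 + 1 / y) ^+ 2).
      by rewrite sqrtrM ?ltW // sqrtr_sqr ger0_norm // addr_ge0 // divr_ge0 // ltW.
    rewrite /r eM; apply: ler_wsqrtr; rewrite -subr_ge0 (_ : _ - _ = 1 + 1 / y).
      by rewrite addr_ge0 // divr_ge0 // ltW.
    by field; rewrite lt0r_neq0.
  move: (binsq_ge0 R n.+1) (binsq R n.+2) => b0 b'.
  move: (binsq R n.+1) b0 (Num.sqrt y) rS => b b0 t rS.
  clearbody r; rewrite -subr_ge0 (_ : _ - _ = pi * b / (6 * q) * (t * (1 + 1 / y) - r)).
    rewrite mulr_ge0 ?subr_ge0 // divr_ge0 ?mulr_ge0 // ltW //.
  by move: (pi) => p; field; rewrite !lt0r_neq0 //; lra.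
- move=> n; set y : R := n.+2%:R; set q : R := 9 ^+ n.+2; set r := Num.sqrt y.
  have y0 : 0 < y by rewrite ltr0n.
  have q0 : 0 < q by rewrite exprn_gt0.
  have eM : n.+3%:R = y + 1 by rewrite -[LHS]natr1.
  apply: (@le_trans _ _ (r / q * (y / pi) * (3 / (4 * y) * binsq R n.+2 +
      (y / 3 + 3) * \sum_(j < n.+3) 'C(n.+2, j)%:R ^+ 2 * 4 ^+ j / j.+1%:R ^+ 2))).
    rewrite /binsq !mulr_sumr -big_split mulr_sumr; apply: ler_sum => j _ /=.
    have j0 : 0 < j.+1%:R :> R by rewrite ltr0n.
    (* [binsq_inv2] controls only the sum of [1 / z^2] for [z = j + 1]; so [1 / z], a concave
       function of [1 / z^2], is bounded by its tangent at the typical value [z = 2 y / 3]. *)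
    have amgm : (j.+1%:R)^-1 <= 3 / (4 * y) + y / 3 / j.+1%:R ^+ 2 :> R.
      rewrite -subr_ge0 (_ : _ - _ = (3 * j.+1%:R - 2 * y) ^+ 2 / (12 * y * j.+1%:R ^+ 2)).
        by rewrite divr_ge0 ?sqr_ge0 // mulr_ge0 ?exprn_ge0 // ?mulr_ge0 // ltW.
      by move: (y) y0 (j.+1%:R) j0 => x x0 z z0; field; rewrite !lt0r_neq0.
    have -> : r * ('C(n.+2, j)%:R ^+ 2 * 4 ^+ j) / q * (y / pi * (j.+1%:R^-1 +
      3 / j.+1%:R ^+ 2)) =
      r / q * (y / pi) * ('C(n.+2, j)%:R ^+ 2 * 4 ^+ j) * (j.+1%:R^-1 +
        3 / j.+1%:R ^+ 2) by ring.
    have -> : 3 / (4 * y) * ('C(n.+2, j)%:R ^+ 2 * 4 ^+ j) +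
         (y / 3 + 3) * ('C(n.+2, j)%:R ^+ 2 * 4 ^+ j / j.+1%:R ^+ 2) =
      ('C(n.+2, j)%:R ^+ 2 * 4 ^+ j) * (3 / (4 * y) + y / 3 / j.+1%:R ^+ 2 +
        3 / j.+1%:R ^+ 2) by ring.
    rewrite -[leLHS]mulrA; apply: ler_wpM2l.
      by rewrite !mulr_ge0 ?sqrtr_ge0 ?invr_ge0 // ltW.
    by apply: ler_wpM2l; [rewrite mulr_ge0 ?sqr_ge0 ?exprn_ge0 | rewrite lerD2r].
  apply: (@le_trans _ _ (r / q * (y / pi) * (3 / (4 * y) * binsq R n.+2 +
      (y / 3 + 3) * (binsq R n.+3 / (4 * (y + 1) ^+ 2))))).
    apply: ler_wpM2l; first by rewrite !mulr_ge0 ?sqrtr_ge0 ?invr_ge0 // ltW.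
    rewrite lerD2l; apply: ler_wpM2l; last by rewrite -eM binsq_inv2.
    by rewrite addr_ge0 ?divr_ge0 // ltW.
  rewrite /a -/y -/r eM (exprS 9 n.+2) -/q; clearbody y q.
  have rS : r <= Num.sqrt (y + 1) by rewrite ler_wsqrtr // lerDl.
  have r0 : 0 <= r by rewrite sqrtr_ge0.
  clearbody r.
  move: (binsq R n.+2) (binsq R n.+3) (binsq_ge0 R n.+3) => b' b b0.
  move: (Num.sqrt (y + 1)) rS => t rS.
  have h : y * (y / 3 + 3) / (4 * (y + 1) ^+ 2) <= 1 / 12 + 3 / 4 / y.
    rewrite -subr_ge0 (_ : _ - _ = (2 * y ^+ 2 + 19 * y + 9) / (12 * y * (y + 1) ^+ 2)).
      rewrite divr_ge0 ?addr_ge0 ?mulr_ge0 ?exprn_ge0 ?addr_ge0 ?mulr_ge0 ?ltW //.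
    by field; rewrite !lt0r_neq0 //; lra.
  have -> : r / q * (y / pi) * (3 / (4 * y) * b' + (y / 3 + 3) * (b / (4 * (y + 1) ^+ 2))) =
     (3 / 4 * (r * b' / q) + r * b / q * (y * (y / 3 + 3) / (4 * (y + 1) ^+ 2))) / pi.
    by move: (pi) pi0 => p p0; field; rewrite !lt0r_neq0 //; lra.
  rewrite ler_pM2r ?invr_gt0 // lerD2l.
  have -> : 9 * (t * b / (9 * q)) = t * b / q by field; rewrite lt0r_neq0.
  apply: ler_pM => //.
  - by rewrite !mulr_ge0 ?invr_ge0 // ltW.
  - by rewrite divr_ge0 ?mulr_ge0 ?addr_ge0 ?divr_ge0 ?exprn_ge0 ?addr_ge0 // ltW.
  by rewrite !ler_wpM2r ?invr_ge0 // ltW.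
- rewrite [X in X @ _](_ : _ = fun n => a n.+1) //.
  apply/funext => n; rewrite /a /binsq mulr_sumr mulr_suml.
  by apply: eq_bigr.
- rewrite s2 [X in _ --> X](_ : _ = pi * ((m + m / 3 * (1 + 0)) / 2 + m * 0)); last first.
    by move: (pi) => p; field.
  apply: cvgM; first exact: cvg_cst.
  apply: cvgD; last by apply: cvgM.
  apply: cvgM; last exact: cvg_cst.
  apply: cvgD => //; apply: cvgM; first by apply: cvgM => //; exact: cvg_cst.
  by apply: cvgD; [exact: cvg_cst | exact: cvg_natV].
rewrite s2 [X in _ --> X](_ : _ = (3 / 4 * m + 9 * m * (1 / 12 + 0)) / pi); last first.
  by move: (pi) pi0 => p p0; field; rewrite lt0r_neq0.
apply: cvgM; last exact: cvg_cst.
apply: cvgD; first by apply: cvgM => //; exact: cvg_cst.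
apply: cvgM; first by apply: cvgM => //; exact: cvg_cst.
by apply: cvgD => //; exact: cvg_cst.
Qed.

(** * The constant term as a sum of binomial products *)

Definition ups : seq (int * int) := [:: 0; (1, 0); (0, 1)].

(* Splits [K^n] as [(1 + 1/x + 1/y)^n] times [(1 + x + y)^n]. *)
Fixpoint dwalk (R : nzRingType) n (m : int * int) : R :=
  if n is k.+1 then \sum_(s <- ups) dwalk R k (m - s) else (m == 0)%:R.

(** The polynomial [(1 + x + y)^n] acting by shifts on functions of lattice points. *)
Fixpoint ustep (R : nzRingType) n (g : int * int -> R) : int * int -> R :=
  if n is k.+1 then ustep k (fun m => \sum_(s <- ups) g (m + s)) else g.

Lemma ustep_ext (R : nzRingType) n (g h : int * int -> R) m :
  (forall x, g x = h x) -> ustep n g m = ustep n h m.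
Proof.
elim: n g h => [|n IH] g h gh /=; first exact: gh.
by apply: IH => x; apply: eq_bigr => s _; apply: gh.
Qed.

Lemma ustep_sum (R : nzRingType) n (r : seq (int * int)) (g : int * int -> R) m :
  ustep n (fun x => \sum_(s <- r) g (x + s)) m = \sum_(s <- r) ustep n g (m + s).
Proof.
elim: n g => [//|n IH] g /=; rewrite -IH; apply: ustep_ext => x.
rewrite exchange_big; apply: eq_bigr => s _; apply: eq_bigr => s' _.
by rewrite addrAC.
Qed.

(** The nine steps are the pairwise differences of the three elements of [ups]. *)
Lemma walk_ustep (R : nzRingType) n m : walk R n m = ustep n (dwalk R n) m.
Proof.
elim: n m => [//|n IH] m.
rewrite [LHS]/= [RHS]/=.
under eq_bigr do rewrite IH.
rewrite -ustep_sum; apply: ustep_ext => x.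
have /(perm_big _) -> : perm_eq steps [seq s - s' | s <- ups, s' <- ups] by [].
rewrite big_allpairs_dep; apply: eq_bigr => s _; apply: eq_bigr => s' _.
by rewrite addrA.
Qed.

Lemma dwalk_neg (R : nzRingType) n (i j : int) : (i < 0) || (j < 0) -> dwalk R n (i, j) = 0.
Proof.
elim: n i j => [|n IH] i j ij /=.
  by rewrite xpair_eqE; case: eqP ij => [->|//]; case: eqP => [->|].
by rewrite big1_seq // => s; rewrite !inE => /or3P[] /eqP ->; apply: IH => /=; lia.
Qed.

Lemma dwalkE (R : nzRingType) n (i j : nat) :
  dwalk R n (i%:Z, j%:Z) = ('C(n, i + j) * 'C(i + j, i))%:R.
Proof.
elim: n i j => [|n IH] i j /=.
  by rewrite xpair_eqE !eqz_nat; case: i j => [|i] [|j].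
rewrite !big_cons big_nil subr0 addr0.
rewrite -[(i%:Z, j%:Z) - (1, 0)]/(i%:Z - 1, j%:Z - 0) -[(i%:Z, j%:Z) - (0, 1)]/(i%:Z -
  0, j%:Z - 1).
rewrite !subr0 IH.
have pred1 k : k.+1%:Z - 1 = k%:Z by rewrite -addn1 PoszD addrK.
case: i j => [|i] [|j]; rewrite ?pred1 ?IH ?(dwalk_neg R n) //.
- by rewrite !addr0 !bin0.
- by rewrite !add0r -natrD !add0n !bin0 binS !muln1.
- by rewrite addr0 -natrD !addn0 !binn !muln1 binS.
rewrite -!natrD; congr (_%:R).
by rewrite !addSn !addnS !binS; ring.
Qed.

Lemma lin2_ustep (R : comNzRingType) n (g : int * int -> R) :
  lin2 (fun i j => g (i%:Z, j%:Z)) ((1 + 'X + 'X%:P) ^+ n) = ustep n g 0.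
Proof.
elim: n g => [|n IH] g; first by rewrite lin2_1.
rewrite exprS !mulrDl mul1r !lin2D lin2X lin2Y !lin2Dl /= -IH; apply: lin2_ext => i j.
by rewrite !big_cons big_nil !ptD !(posz1, addr0) addrA.
Qed.

Lemma lin2Xn (R : comNzRingType) (g : nat -> nat -> R) a b :
  lin2 g ('X ^+ a * 'X%:P ^+ b) = g a b.
Proof.
elim: a g => [|a IH] g; last by rewrite exprS -mulrA lin2X IH.
rewrite mul1r; elim: b g => [|b IH] g; first by rewrite lin2_1.
by rewrite exprS lin2Y IH.
Qed.

Lemma lin2Mn (R : comNzRingType) (g : nat -> nat -> R) f k : lin2 g (f *+ k) = lin2 g f *+ k.
Proof. by elim: k => [|k IH]; rewrite ?mulr0n ?lin2_0 // !mulrS lin2D IH. Qed.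

(** The constant term is a sum of squared trinomial coefficients; for [i + j = k] fixed,
    Vandermonde's identity sums the squares of [C(k, i)] to [C(2 k, k)]. *)
Lemma hw00_bin2sum (R : comNzRingType) n : hw R n 0 0 = bin2sum R n.
Proof.
rewrite /hw walk_ustep [LHS](_ : _ = ustep n (dwalk R n) 0) // -lin2_ustep -addrA exprDn
  lin2_sum.
apply: eq_bigr => k _; rewrite expr1n mul1r lin2Mn exprDn lin2_sum.
have -> : \sum_(a < k.+1) lin2 (fun i j => dwalk R n (i%:Z, j%:Z))
    ('X ^+ (k - a) * 'X%:P ^+ a *+ 'C(k, a)) = 'C(n, k)%:R * 'C(k.*2, k)%:R.
  rewrite -addnn -binomial.Vandermonde natr_sum mulr_sumr; apply: eq_bigr => a _.
  have lea : (a <= k)%N by rewrite -ltnS.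
  rewrite lin2Mn lin2Xn dwalkE subnK // bin_sub // -mulr_natr !natrM.
  by ring.
by rewrite -mulr_natr; ring.
Qed.

(** * Recurrence, differential equation and asymptotics *)

Lemma C3_awalk (R : numDomainType) n : (C3 n.+1)%:R = awalk R n (2, 1).
Proof. by rewrite C3_ncount ncount_awalk. Qed.

Lemma C3_small : [/\ C3 0 = 1%N, C3 1 = 1%N & C3 2 = 2%N].
Proof. by rewrite !C3_ncount /= !big_cons !big_nil. Qed.

Lemma C3_rec (R : numFieldType) : C3_recurrence (fun n => (C3 n)%:R : R).
Proof.
have [c0 c1 c2] := C3_small; rewrite /C3_recurrence c0 c1; split=> // -[|n].
  by rewrite c0 c1 c2; ring.
rewrite !C3_awalk -[RHS](awalk21_rec R n); ring.
Qed.

(** Cauchy product with a polynomial given by its coefficient list, in a form that unfolds to a ring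
    expression. *)
Fixpoint conv_seq (R : nzRingType) (s : seq R) (a : nat -> R) (n : nat) : R :=
  if s is c :: s' then c * a n + (if n is k.+1 then conv_seq s' a k else 0) else 0.

Lemma fps_mul_Poly (R : nzRingType) (s : seq R) (a : nat -> R) n :
  fps_mul (fps_of_poly (Poly s)) a n = conv_seq s a n.
Proof.
rewrite /fps_mul /fps_of_poly; under eq_bigr do rewrite coef_Poly.
elim: s n => [|c s IH] n /=; first by rewrite big1 // => i _; rewrite nth_nil mul0r.
rewrite big_ord_recl subn0; congr (_ + _).
by case: n => [|n]; rewrite ?big_ord0 // -IH; apply: eq_bigr.
Qed.

Lemma C3_recurrence_ode (R : realType) (a : nat -> R) : C3_recurrence a <-> C3_ode a.
Proof.
have PolyE (s : seq R) : Poly s = foldr (fun c p => p * 'X + c%:P) 0 s.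
  by elim: s => //= c s ->; rewrite cons_poly_def.
have e1 : 'X^2 * (1 - 9 * 'X) * (1 - 'X) = Poly [:: 0; 0; 1; -10; 9] :> {poly R}.
  by rewrite PolyE /= polyCN !polyC_natr polyC1 polyC0; ring.
have e2 : 2 * 'X * (5 - 27 * 'X + 18 * 'X^2) = Poly [:: 0; 10; -54; 36] :> {poly R}.
  by rewrite PolyE /= polyCN !polyC_natr polyC0; ring.
have e3 : 10 * (2 - 3 * 'X) = Poly [:: 20; -30] :> {poly R}.
  by rewrite PolyE /= polyCN !polyC_natr; ring.
have e4 n : fps_of_poly (20 : {poly R}) n = if n is 0 then 20 else 0.
  by rewrite /fps_of_poly -polyC_natr coefC; case: n.
pose f n := conv_seq [:: 0; 0; 1; -10; 9] (fps_deriv (fps_deriv a)) n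
  + conv_seq [:: 0; 10; -54; 36] (fps_deriv a) n + conv_seq [:: 20; -30] a n
  - (if n is 0 then 20 else 0).
have odeE : C3_ode a <-> forall n, f n = 0.
  rewrite /C3_ode e1 e2 e3; split=> [h n|h].
    move/(congr1 (fun g => g n)): h.
    by rewrite /f -e4 -!fps_mul_Poly.
  by apply/funext => n; have := h n; rewrite /f -e4 -!fps_mul_Poly.
(* The coefficients of index 0 and 1 encode the initial values; that of index [m + 2] is the
   recurrence at [m]. *)
have fE n : f n = match n with
    | 0 => 20 * (a 0%N - 1) | 1 => 30 * (a 1%N - a 0%N)
    | m.+2 => 9 * m%:R * (m%:R + 3) * a m - 2 * (5 * m%:R ^+ 2 + 32 * m%:R + 42) * a m.+1
      + (m%:R + 7) * (m%:R + 6) * a m.+2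
    end.
  (* The convolutions reach back up to four places, so small indices unfold separately. *)
  case: n => [|[|[|[|[|n]]]]]; rewrite /f /= /fps_deriv; ring.
rewrite odeE; split=> [[a0 a1 rec] [|[|n]]|h].
- by rewrite fE a0 subrr mulr0.
- by rewrite fE a0 a1 subrr mulr0.
- by rewrite fE rec.
have nz k : k.+1%:R != 0 :> R by rewrite pnatr_eq0.
have a0 : a 0%N = 1.
  by have := h 0; rewrite fE => /eqP; rewrite mulf_eq0 (negPf (nz _)) subr_eq0 => /eqP.
have a1 : a 1%N = 1.
  by have := h 1; rewrite fE => /eqP; rewrite mulf_eq0 (negPf (nz _)) subr_eq0 a0 => /eqP.
by split=> // n; have := h n.+2; rewrite fE.
Qed.

(** * Ratio of consecutive terms and the final asymptotics *)

Lemma cvg_horner (R : realType) (p : {poly R}) (x : nat -> R) :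
  x @ \oo --> 0 -> (fun n => p.[x n]) @ \oo --> p`_0.
Proof. by move=> cx; rewrite -horner_coef0; apply: continuous_cvg => //;
  exact: continuous_horner. Qed.

(** The bound 3 on the ratio propagates, since it lets the positive term of the recurrence absorb
    the negative one. It starts with equality at [C3 3 = 5] and [C3 4 = 15]. *)
Lemma C3_growth (R : realFieldType) n :
  0 < awalk R n.+2 (2, 1) /\ 3 * awalk R n.+2 (2, 1) <= awalk R n.+3 (2, 1).
Proof.
elim: n => [|n [IH0 IH3]].
  have [_ c1 c2] := C3_small; have := awalk21_rec R 1; have := awalk21_rec R 0.
  rewrite -[awalk R 0 _]C3_awalk -[awalk R 1 _]C3_awalk c1 c2.
  by split; lra.
have c0 : 0 < awalk R n.+3 (2, 1) by lra.
split=> //; have := awalk21_rec R n.+2; have : 0 <= n%:R :> R by [].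
have -> : n.+2%:R = n%:R + 2 :> R by rewrite -addn2 natrD.
move: (n%:R) (awalk R n.+2 _) (awalk R n.+3 _) (awalk R n.+4 _) IH0 IH3 c0 => x a b c a0 ab b0
  x0 e.
have x8 : 0 < (x + 10) * (x + 9) by rewrite mulr_gt0 //; lra.
have h : 9 * (x + 3) * (x + 6) * a <= 3 * (x + 3) * (x + 6) * b.
  rewrite (_ : _ * a = 3 * (x + 3) * (x + 6) * (3 * a)); last by ring.
  by apply: ler_wpM2l => //; rewrite !mulr_ge0 //; lra.
rewrite -(ler_pM2l x8).
have h2 : 0 <= (4 * x ^+ 2 + 40 * x + 42) * b.
  by rewrite mulr_ge0 ?addr_ge0 ?mulr_ge0 ?sqr_ge0 // ltW.
lra.
Qed.

(** The recurrence expresses [c - 9 b] through [b - 9 a], and [3 a <= b] divides the inherited error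
    by 3. To leading order a bound [D / (n + 3)] persists when [D / 3 + 56 <= D], which 102
    satisfies with room to spare. *)
Lemma C3_ratio (R : realFieldType) n :
  `|awalk R n.+3 (2, 1) / awalk R n.+2 (2, 1) - 9| <= 102 / (n%:R + 3).
Proof.
have [c0 _] := C3_growth R n.
suff h : `|awalk R n.+3 (2, 1) - 9 * awalk R n.+2 (2, 1)| <= 102 / (n%:R +
  3) * awalk R n.+2 (2, 1).
  rewrite -(ler_pM2r c0) -{2}(gtr0_norm c0) -normrM mulrBl divfK ?lt0r_neq0 //.
elim: n {c0} => [|n IH].
  have [_ c1 c2] := C3_small; have := awalk21_rec R 1; have := awalk21_rec R 0.
  rewrite -[awalk R 0 _]C3_awalk -[awalk R 1 _]C3_awalk c1 c2 => e0 e1.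
  have -> : awalk R 3 (2, 1) = 15 by lra.
  have -> : awalk R 2 (2, 1) = 5 by lra.
  by rewrite add0r ler_norml; apply/andP; split; lra.
have [a0 ab] := C3_growth R n; have [b0 _] := C3_growth R n.+1; move: IH.
have := awalk21_rec R n.+2; have : 0 <= n%:R :> R by [].
have -> : n.+2%:R = n%:R + 2 :> R by rewrite -addn2 natrD.
have -> : n.+1%:R = n%:R + 1 :> R by rewrite -addn1 natrD.
move: (n%:R) (awalk R n.+2 _) (awalk R n.+3 _) (awalk R n.+4 _) a0 ab b0 => x a b c a0 ab b0
  x0 e IH.
have x8 : 0 < (x + 10) * (x + 9) by rewrite mulr_gt0 //; lra.
rewrite -(ler_pM2l x8) -{1}(gtr0_norm x8) -normrM.
have -> : (x + 10) * (x + 9) * (c - 9 * b) =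
    (x + 3) * (x + 6) * (b - 9 * a) - (56 * x + 462) * b by lra.
apply: le_trans (ler_normB _ _) _; rewrite !normrM.
rewrite (@ger0_norm _ (x + 3)) ?(@ger0_norm _ (x + 6)) ?(@ger0_norm _ (56 * x +
  462)) ?(@ger0_norm _ b); [|lra..].
have h1 : (x + 3) * (x + 6) * `|b - 9 * a| <= (x + 6) * 34 * b.
  apply: (@le_trans _ _ ((x + 3) * (x + 6) * (102 / (x + 3) * a))).
    by rewrite ler_wpM2l // mulr_ge0 //; lra.
  rewrite (_ : (x + 3) * (x + 6) * _ = (x + 6) * 34 * (3 * a)); last by field; lra.
  by rewrite ler_wpM2l // mulr_ge0 //; lra.
apply: le_trans (lerD h1 (lexx _)) _; rewrite -mulrDl mulrA ler_pM2r //.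
have -> : (x + 10) * (x + 9) * (102 / (x + 1 + 3)) = (x + 10) * (x + 9) * 102 / (x +
  4) by field; lra.
rewrite ler_pdivlMr; last by lra.
have := mulr_ge0 x0 x0; lra.
Qed.

Lemma C3_ratio_cvg (R : realType) :
  (fun n => awalk R n.+3 (2, 1) / awalk R n.+2 (2, 1)) @ \oo --> (9 : R).
Proof.
have c0 : (fun n => 102 / (n%:R + 3)) @ \oo --> (0 : R).
  rewrite [X in X @ _](_ : _ = fun n => 102 / n.+3%:R).
    rewrite (cvg_shiftS (fun n => 102 / n.+2%:R : R)) (cvg_shiftS (fun n => 102 / n.+1%:R : R)).
    exact: cvg_natV.
  by apply/funext => n; rewrite -natrD addn3.
apply: (@squeeze_cvgr _ _ _ _ (fun n => 9 - 102 / (n%:R + 3)) (fun n => 9 + 102 / (n%:R + 3))).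
- near=> n; have := C3_ratio R n; rewrite ler_norml => /andP[h1 h2].
  by apply/andP; split; lra.
- by rewrite -[X in _ --> X](subr0 9); apply: cvgB => //; exact: cvg_cst.
by rewrite -[X in _ --> X](addr0 9); apply: cvgD => //; exact: cvg_cst.
Unshelve. all: by end_near.
Qed.

Lemma bin2sum_limitE (R : realType) :
  1 / 2 / Num.sqrt (2 * pi / 9) / Num.sqrt (2 * pi / 3) = 3 / 4 * (Num.sqrt 3 / pi) :> R.
Proof.
have pi0 := pi_gt0 R.
have s9 : 0 <= 2 * pi / 9 :> R by lra.
have e : Num.sqrt (2 * pi / 9) * Num.sqrt (2 * pi / 3) = 2 * pi / 9 * Num.sqrt 3 :> R.
  rewrite -(sqrtrM _ s9) (_ : _ * (2 * pi / 3) = (2 * pi / 9) ^+ 2 * 3); last by field.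
  by rewrite sqrtrM ?sqr_ge0 // sqrtr_sqr ger0_norm.
have s3 : Num.sqrt 3 ^+ 2 = 3 :> R by rewrite sqr_sqrtr.
have s30 : 0 < Num.sqrt 3 :> R by rewrite sqrtr_gt0.
rewrite -mulrA -invfM e; move: (Num.sqrt 3) (pi) s3 s30 pi0 => s p s3 s0 p0.
rewrite (_ : s / p = 3 / (s * p)); last by rewrite -s3; field; rewrite !lt0r_neq0.
by field; rewrite !lt0r_neq0.
Qed.

(** [D] stands for the right side of [hw00E] divided by [y^9 a]; it is nonzero because the other
    side is positive. *)
Lemma ratio_of_constant_term (R : realFieldType) (B y q a S D : R) :
  0 < B -> 0 < y -> q != 0 -> 0 < a -> 0 < S ->
  D * (y ^+ 9 * a) = B * (y + 1) * (y + 2) * (y + 3) * S ->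
  a / (9 * q / (y + 1) ^+ 7) =
  y * S / q * (B / 9 * ((1 + y^-1) ^+ 8 * (1 + 2 * y^-1) * (1 + 3 * y^-1))) / D.
Proof.
move=> B0 y0 q0 a0 S0 DE.
have D0 : D != 0.
  apply: contraTneq (_ : 0 < B * (y + 1) * (y + 2) * (y + 3) * S) => [D0|].
    by rewrite -DE D0 mul0r ltxx.
  by rewrite !mulr_gt0 //; lra.
have -> : S = D * (y ^+ 9 * a) / (B * (y + 1) * (y + 2) * (y + 3)).
  by rewrite DE; field; rewrite !lt0r_neq0 //; lra.
by field; rewrite q0 D0 !lt0r_neq0 //; lra.
Qed.

Lemma C3_cvg (R : realType) :
  (fun n => (C3 n.+3)%:R / (9 ^+ n.+3 / n.+3%:R ^+ 7) : R) @ \oo -->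
  3 ^+ 9 * 5 / 2 ^+ 5 * (Num.sqrt 3 / pi).
Proof.
(* This is [3^10 * 5], the source of the powers of 3 in the limit. *)
pose big : R := 295 * 1000 + 245.
(* The polynomials of [hw00E] with coefficients by decreasing degree, so that evaluation at [1 / y]
   divides them by [y^9]. *)
pose q1 : seq R := [:: -4; -153; -(2 * 1000 + 553); -(24 * 1000 + 381);
  -(209 * 1000 + 127); -((1 * 1000 + 404) * 1000 + 216); -((5 * 1000 + 621) * 1000 + 792);
  -((12 * 1000 + 129) * 1000 + 354); -((12 * 1000 + 942) * 1000 + 324); -((5 * 1000 +
    347) * 1000 + 296)].
pose q2 : seq R := [:: 4; 165; 2 * 1000 + 994; 31 * 1000 + 401; 217 * 1000 + 110;
  (1 * 1000 + 74) * 1000 + 645; (3 * 1000 + 829) * 1000 + 604; (8 * 1000 + 975) * 1000 + 697;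
  (11 * 1000 + 730) * 1000 + 384; (6 * 1000 + 216) * 1000 + 588].
pose num : {poly R} := (1 + 'X) ^+ 8 * (1 + 2%:P * 'X) * (1 + 3%:P * 'X).
pose x n : R := n.+2%:R^-1.
have cx : x @ \oo --> 0.
  by rewrite (cvg_shiftS (fun n => n.+1%:R^-1 : R)); exact: cvg_harmonic.
pose r n := awalk R n.+3 (2, 1) / awalk R n.+2 (2, 1).
rewrite [X in X @ _](_ : _ = fun n => (n.+2%:R * bin2sum R n.+2 / 9 ^+ n.+2) *
   (4 * big / 9 * num.[x n]) / ((Poly q1).[x n] + (Poly q2).[x n] * r n)); last first.
  apply/funext => n; rewrite C3_awalk.
  have [a0 _] := C3_growth R n; have [b0 _] := C3_growth R n.+1.
  have S0 : 0 < bin2sum R n.+2.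
    rewrite /bin2sum big_ord_recl; apply: ltr_wpDr; last by rewrite !bin0 expr1n mulr1.
    by apply: sumr_ge0 => i _; rewrite mulr_ge0 ?sqr_ge0.
  have y0 : 0 < n.+2%:R :> R by rewrite ltr0n.
  have D0 : ((Poly q1).[x n] + (Poly q2).[x n] * r n) * (n.+2%:R ^+ 9 * awalk R n.+2 (2, 1)) =
      4 * big * (n.+2%:R + 1) * (n.+2%:R + 2) * (n.+2%:R + 3) * bin2sum R n.+2.
    rewrite -hw00_bin2sum /big hw00E /r /x !horner_Poly /=.
    move: (n.+2%:R) y0 (awalk R n.+2 _) a0 (awalk R n.+3 _) => y y0 a a0 b.
    by field; rewrite !lt0r_neq0.
  have Bpos : 0 < 4 * big by rewrite mulr_gt0 // addr_gt0 // mulr_gt0.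
  have numE : num.[x n] = (1 + n.+2%:R^-1) ^+ 8 * (1 + 2 * n.+2%:R^-1) * (1 + 3 * n.+2%:R^-1).
    by rewrite /num !(hornerE, horner_exp).
  rewrite numE -[n.+3%:R]natr1 (exprS 9).
  by apply: ratio_of_constant_term; rewrite // expf_neq0 ?pnatr_eq0.
have L : 3 ^+ 9 * 5 / 2 ^+ 5 * (Num.sqrt 3 / pi) =
    3 / 4 * (Num.sqrt 3 / pi) * (4 * big / 9 * num`_0) / ((Poly q1)`_0 + (Poly q2)`_0 * 9).
  have -> : num`_0 = 1.
    by rewrite -horner_coef0 /num -polyC1 !(horner_exp, hornerM, hornerD, hornerX, hornerC);
      ring.
  by move: (Num.sqrt 3 / pi) => z; rewrite !coef_Poly /= /big; field.
rewrite L -bin2sum_limitE; apply: cvgM.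
  apply: cvgM; first exact: bin2sum_cvg.
  by apply: cvgM; [exact: cvg_cst|exact: cvg_horner].
apply: cvgV; last first.
  apply: cvgD; first exact: cvg_horner.
  by apply: cvgM; [exact: cvg_horner|exact: C3_ratio_cvg].
(* The denominator tends to [-4 + 4 * 9 = 32]. *)
by rewrite !coef_Poly /= lt0r_neq0 //; lra.
Qed.

Lemma C3_equiv (R : realType) :
  (fun n : nat => (C3 n)%:R : R^o) ~_\oo
  (fun n : nat => 3 ^+ 9 * 5 / 2 ^+ 5 * (Num.sqrt 3 / pi) * (9 ^+ n / n%:R ^+ 7) : R^o).
Proof.
apply/eqaddoP => e e0.
pose g n : R := 9 ^+ n / n%:R ^+ 7.
pose K : R := 3 ^+ 9 * 5 / 2 ^+ 5 * (Num.sqrt 3 / pi).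
have cK : (fun n => (C3 n)%:R / g n) @ \oo --> K.
  rewrite -(cvg_shiftS (fun n => (C3 n)%:R / g n)).
  rewrite -(cvg_shiftS (fun n => (C3 n.+1)%:R / g n.+1)).
  rewrite -(cvg_shiftS (fun n => (C3 n.+2)%:R / g n.+2)).
  exact: C3_cvg.
have K0 : 0 < K by rewrite mulr_gt0 ?divr_gt0 ?mulr_gt0 ?exprn_gt0 ?sqrtr_gt0 ?pi_gt0.
have /cvgrPdist_le/(_ (e * K) (mulr_gt0 e0 K0)) near_K := cK.
near=> n.
(* At [n = 0] the inverse of 0 is 0, so [g] vanishes there and is positive only afterwards. *)
have n0 : (0 < n)%N by near: n; exact: nbhs_infty_gt.
have g0 : 0 < g n by rewrite divr_gt0 ?exprn_gt0 ?ltr0n.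
rewrite -[X in `|X| <= _]/((C3 n)%:R - K * g n) -[X in _ <= _ * `|X|]/(K * g n).
have -> : `|(C3 n)%:R - K * g n| = `|K - (C3 n)%:R / g n| * g n.
  by rewrite -[X in _ = _ * X](gtr0_norm g0) -normrM mulrBl divfK ?lt0r_neq0 // distrC.
rewrite (gtr0_norm (mulr_gt0 K0 g0)) [e * _]mulrA ler_pM2r //.
by near: n; exact: near_K.
Unshelve. all: by end_near.
Qed.

Theorem proposition1 (R : realType) :
  [/\ C3_recurrence (fun n : nat => (C3 n)%:R : R),
      C3_ode (fun n : nat => (C3 n)%:R : R),
      (forall a : nat -> R, C3_recurrence a <-> C3_ode a) &
      (fun n : nat => (C3 n)%:R : R^o) ~_\oo
      (fun n : nat => 3 ^+ 9 * 5 / 2 ^+ 5 * (Num.sqrt 3 / pi)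
                      * (9 ^+ n / n%:R ^+ 7) : R^o)].
Proof.
split; [exact: C3_rec | by apply/C3_recurrence_ode/C3_rec | exact: C3_recurrence_ode |].
exact: C3_equiv.
Qed.
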